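(* In the Grothendieck group $G_0(kG^F)$ of finitely generated $kG^F$-modules one has $$[H^0(C_k,\Omega^1_{C_k})]_k=\sum_{i=0}^{q-2}[V_i]_k,$$ where $V_i:=\mathrm{Sym}^i(k^2)$, with $k^2$ the natural representation of $G^F=\mathrm{SL}_2(\mathbb{F}_q)\subseteq \mathrm{GL}_2(k)$.
   Context: Let $q$ be a power of a prime $p$, let $G=\mathrm{SL}_2$ over $\mathbb{F}_q$ with geometric Frobenius endomorphism $F$, so that $G^F=\mathrm{SL}_2(\mathbb{F}_q)$. Let $C/\mathbb{F}_q$ be the projective Drinfeld curve, i.e. the plane curve $XY^q-X^qY-Z^{q+1}=0$ in $\mathbb{P}^2$. The group $G^F$ acts on $C$ by left matrix multiplication on the column vector $\begin{bmatrix}X \\ Y\end{bmatrix}$ (fixing $Z$). Let $K$ be a finite extension of $\mathrm{Frac}(W(\mathbb{F}_q))$ (where $W(\mathbb{F}_q)$ is the ring of Witt vectors over $\mathbb{F}_q$) such that every complex irreducible representation of $G^F$ is realisable over $K$, and let $k$ be the residue field of $K$. $C_k$ denotes the base change of $C$ to $k$, and $H^0(C_k,\Omega^1_{C_k})$ is the space of global holomorphic (regular) differential forms, a $kG^F$-module via the induced action of $G^F$. For a finitely generated $kG^F$-module $M$, $[M]_k$ denotes its class in $G_0(kG^F)$. *)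

(* Defs.v *)
From HB Require Import structures.
From mathcomp Require Import all_boot all_order all_algebra all_fingroup.
From mathcomp Require Import all_field all_character.
From mathcomp Require Import ring_quotient fraction.
From mathcomp Require Import boolp reals.
From mathcomp.real_closed Require Import complex.
From mathcomp.multinomials Require Import freeg mpoly.

Set Implicit Arguments.
Unset Strict Implicit.
Unset Printing Implicit Defensive.

Import GRing.Theory.
Local Open Scope ring_scope.

(* A finitely generated left kG-module is a matrix representation
   r : G -> GL_n(k), with g acting on column vectors by v |-> r g *m v. *)
Section Grothendieck.

Variables (k : fieldType) (gT : finGroupType) (G : {group gT}).

Definition fg_module : Type := {n : nat & mx_representation k G n}.

Definition intertwines m n (r : mx_representation k G m)
    (s : mx_representation k G n) (f : 'M[k]_(n, m)) : Prop :=
  forall g, g \in G -> f *m r g = s g *m f.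

Definition short_exact n1 n n2 (r1 : mx_representation k G n1)
    (r : mx_representation k G n) (r2 : mx_representation k G n2) : Prop :=
  exists (f : 'M[k]_(n, n1)) (h : 'M[k]_(n2, n)),
    [/\ intertwines r1 r f, intertwines r r2 h,
        forall u : 'cV[k]_n1, f *m u = 0 -> u = 0,
        forall w : 'cV[k]_n2, exists v : 'cV[k]_n, h *m v = w
      & forall v : 'cV[k]_n, h *m v = 0 <-> exists u : 'cV[k]_n1, v = f *m u].

Definition free_on_modules : zmodType := {freeg {classic fg_module} / int}.

Definition gen n (r : mx_representation k G n) : free_on_modules :=
  << (existT _ n r : {classic fg_module}) >>.

Definition G0_relations : {pred free_on_modules} := fun x =>
  `[< forall S : {pred free_on_modules}, zmod_closed S ->
      (forall n1 n n2 (r1 : mx_representation k G n1)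
          (r : mx_representation k G n) (r2 : mx_representation k G n2),
        short_exact r1 r r2 -> gen r - gen r1 - gen r2 \in S) ->
      x \in S >].

Lemma G0_relations_zmod_closed : zmod_closed G0_relations.
Proof.
split=> [|x y]; first by apply/asboolP=> S [].
move=> /asboolP Hx /asboolP Hy; apply/asboolP=> S clS relS.
by apply: clS.2; [apply: Hx | apply: Hy].
Qed.

HB.instance Definition _ :=
  GRing.isZmodClosed.Build free_on_modules G0_relations
    G0_relations_zmod_closed.

Definition G0 : zmodType := Quotient.quot G0_relations.

Definition G0_class n (r : mx_representation k G n) : G0 :=
  (\pi_G0 (gen r))%qT.

End Grothendieck.

Section SL2.

Variable Fq : finFieldType.

Definition SL2 : {set {'GL_2[Fq]}} := [set g | \det (GLval g) == 1].

Lemma SL2_group_set : group_set SL2.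
Proof.
apply/group_setP; split=> [|g h]; first by rewrite inE GL_1E det1.
by rewrite !inE GL_ME => /eqP dg /eqP dh; rewrite det_mulmx dg dh mulr1.
Qed.

Canonical SL2_group := Group SL2_group_set.

End SL2.

Section SymmetricPower.

Variable k : fieldType.

Implicit Types (A B : 'M[k]_2) (P : {mpoly k[2]}).

(* Sym(k^2) is k['X_0, 'X_1], where 'X_0, 'X_1 is the standard basis of k^2;
   A acts by the algebra endomorphism sending 'X_j to the vector
   \sum_l A l j *: 'X_l, the j-th column of A. *)
Definition sym_act A P : {mpoly k[2]} :=
  P \mPo [tuple \sum_l A l j *: 'X_l | j < 2].

Definition sym_mon i (l : 'I_i.+1) : 'X_{1..2} :=
  [multinom [tuple (i - l)%N; l : nat]].

(* The matrix of A on Sym^i(k^2), in the basis of the monomials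
   'X_0^(i-l) 'X_1^l. *)
Definition sym_mx i A : 'M[k]_i.+1 :=
  \matrix_(l, j) (sym_act A 'X_[sym_mon j])@_(sym_mon l).

Lemma sym_act_sum A (I : Type) (s : seq I) (c : I -> k)
    (P : I -> {mpoly k[2]}) :
  sym_act A (\sum_(x <- s) c x *: P x) = \sum_(x <- s) c x *: sym_act A (P x).
Proof. by rewrite /sym_act raddf_sum; apply: eq_bigr => x _; rewrite /= comp_mpolyZ. Qed.

Lemma sym_actX A j : sym_act A 'X_j = \sum_l A l j *: 'X_l.
Proof. by rewrite /sym_act /comp_mpoly mmapX mmap1U tnth_mktuple. Qed.

Lemma sym_actXm A m : sym_act A 'X_[m] = \prod_j sym_act A 'X_j ^+ m j.
Proof.
rewrite {1}/sym_act comp_mpolyX; apply: eq_bigr => j _.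
by rewrite sym_actX tnth_mktuple.
Qed.

Lemma sym_act1 P : sym_act 1%:M P = P.
Proof.
rewrite -[RHS]comp_mpoly_id /sym_act; congr (P \mPo _).
apply: eq_from_tnth => j; rewrite !tnth_mktuple (bigD1 j) //= mxE eqxx scale1r.
by rewrite big1 ?addr0 // => l /negPf nlj; rewrite mxE nlj scale0r.
Qed.

Lemma sym_actM A B P : sym_act (A *m B) P = sym_act A (sym_act B P).
Proof.
rewrite [P]mpolyE !sym_act_sum; apply: eq_bigr => m _; congr (_ *: _).
rewrite [LHS]sym_actXm [sym_act B _]sym_actXm {2}/sym_act rmorph_prod /=.
apply: eq_bigr => j _; rewrite rmorphXn /=; congr (_ ^+ _).
rewrite -/(sym_act A _) !sym_actX sym_act_sum.
under [RHS]eq_bigr => l _ do rewrite sym_actX scaler_sumr.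
rewrite exchange_big /=; apply: eq_bigr => l _.
rewrite mxE scaler_suml; apply: eq_bigr => h _.
by rewrite scalerA mulrC.
Qed.

Lemma mdeg_sym_mon i (l : 'I_i.+1) : mdeg (sym_mon l) = i.
Proof.
by rewrite mdegE big_ord_recl big_ord1 !multinomE /= !(tnth_nth 0%N) /= subnK // -ltnS.
Qed.

Lemma sym_mon_inj i : injective (@sym_mon i).
Proof.
move=> l l' /mnmP/(_ (fintype.lift ord0 ord0)); rewrite !multinomE !(tnth_nth 0%N) /=.
exact: ord_inj.
Qed.

Lemma sym_monP i (m : 'X_{1..2}) :
  mdeg m = i -> exists l : 'I_i.+1, m = sym_mon l.
Proof.
rewrite mdegE big_ord_recl big_ord1 => dm.
have lt_m : (m (fintype.lift ord0 ord0) < i.+1)%N by rewrite ltnS -dm leq_addl.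
exists (Ordinal lt_m); apply/mnmP => j; rewrite multinomE (tnth_nth 0%N) /=.
case: (unliftP ord0 j) => [j' ->|->]; first by rewrite ord1.
by rewrite /= -[in RHS]dm addnK.
Qed.

Lemma sym_act_homog A P i : P \is i.-homog -> sym_act A P \is i.-homog.
Proof.
move=> /dhomogP homP; rewrite [P]mpolyE sym_act_sum big_seq.
apply: rpred_sum => m /homP dm; apply: rpredZ; rewrite sym_actXm -dm.
rewrite /= mdegE !big_ord_recl !big_ord0 mulr1 addn0.
have homX j : sym_act A 'X_j \is 1.-homog.
  by rewrite sym_actX; apply: rpred_sum => l _; apply: rpredZ; rewrite dhomogX /= mdeg1.
by apply: dhomogM; rewrite -[X in X.-homog]mul1n; apply: dhomogMn.
Qed.

Lemma sym_homogE P i : P \is i.-homog ->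
  P = \sum_(l < i.+1) P@_(sym_mon l) *: 'X_[sym_mon l].
Proof.
move=> homP; apply/mpolyP => m; rewrite raddf_sum /=.
have [dm|dm] := eqVneq (mdeg m) i; last first.
  rewrite (dhomog_nemf_coeff homP dm) big1 // => l _; rewrite mcoeffZ mcoeffX.
  have [lm|_] := eqVneq (sym_mon l) m; last by rewrite mulr0.
  by rewrite -lm mdeg_sym_mon eqxx in dm.
have [l ->] := sym_monP dm; rewrite (bigD1 l) //= mcoeffZ mcoeffX eqxx mulr1.
rewrite big1 ?addr0 // => l' nl; rewrite mcoeffZ mcoeffX.
by rewrite (inj_eq (@sym_mon_inj i)) (negPf nl) mulr0.
Qed.

Lemma sym_mx1 i : sym_mx i 1%:M = 1%:M.
Proof.
apply/matrixP => l j; rewrite !mxE sym_act1 mcoeffX.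
by rewrite (inj_eq (@sym_mon_inj i)) eq_sym.
Qed.

Lemma sym_mxM i A B : sym_mx i (A *m B) = sym_mx i A *m sym_mx i B.
Proof.
apply/matrixP => l j; rewrite !mxE sym_actM.
have homB : sym_act B 'X_[sym_mon j] \is i.-homog.
  by apply: sym_act_homog; rewrite dhomogX /= mdeg_sym_mon.
rewrite {1}(sym_homogE homB) sym_act_sum raddf_sum /=.
by apply: eq_bigr => h _; rewrite mcoeffZ !mxE mulrC.
Qed.

Variables (Fq : finFieldType) (iota : {rmorphism Fq -> k}).

Definition natural_mx (g : {'GL_2[Fq]}) : 'M[k]_2 := map_mx iota (GLval g).

Lemma sym_mx_repr i : mx_repr (SL2 Fq) (fun g => sym_mx i (natural_mx g)).
Proof.
split=> [|g h _ _]; first by rewrite /natural_mx GL_1E map_mx1 sym_mx1.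
by rewrite /natural_mx GL_ME map_mxM sym_mxM.
Qed.

Definition sym_repr i : mx_representation k (SL2_group Fq) i.+1 :=
  MxRepresentation (sym_mx_repr i).

End SymmetricPower.

(* The ring of Witt vectors of Fq is the strict p-ring with residue field Fq:
   p-torsion-free (that is, p <> 0, as W is a domain), separated and
   complete for the p-adic topology, with W / pW = Fq via redW. *)
Record is_witt_ring (p : nat) (Fq : finFieldType) (W : idomainType)
    (redW : {rmorphism W -> Fq}) : Prop := IsWittRing {
  witt_p_neq0 : p%:R != 0 :> W;
  witt_red_surj : forall a : Fq, exists w : W, redW w = a;
  witt_red_ker : forall w : W, redW w = 0 <-> exists v : W, w = p%:R * v;
  witt_separated : forall w : W,
    (forall n, exists v : W, w = p%:R ^+ n * v) -> w = 0;
  witt_complete : forall u : nat -> W,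
    (forall n, exists v : W, u n.+1 - u n = p%:R ^+ n * v) ->
    exists l : W, forall n, exists v : W, l - u n = p%:R ^+ n * v
}.

Section RingOfIntegers.

Variables (W : idomainType) (K : fieldExtType {fraction W}).

Definition W_to_K (w : W) : K := (tofrac w)%:A.

Lemma W_to_K_zmod_morphism : zmod_morphism W_to_K.
Proof. by move=> x y; rewrite /W_to_K rmorphB /= scalerBl. Qed.

Lemma W_to_K_monoid_morphism : monoid_morphism W_to_K.
Proof.
split=> [|x y]; rewrite /W_to_K ?rmorph1 ?scale1r // rmorphM /=.
by rewrite -scalerAl mul1r scalerA.
Qed.

HB.instance Definition _ :=
  GRing.isZmodMorphism.Build W K W_to_K W_to_K_zmod_morphism.
HB.instance Definition _ :=
  GRing.isMonoidMorphism.Build W K W_to_K W_to_K_monoid_morphism.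

Definition integral_pred : {pred K} := fun x => `[< integralOver W_to_K x >].

Lemma integral_subring_closed : subring_closed integral_pred.
Proof.
split=> [|x y /asboolP xI /asboolP yI|x y /asboolP xI /asboolP yI].
- exact/asboolP/integral1.
- exact/asboolP/integral_sub.
- exact/asboolP/integral_mul.
Qed.

HB.instance Definition _ :=
  GRing.isSubringClosed.Build K integral_pred integral_subring_closed.

(* The valuation ring of K is the integral closure of W in K. *)
Record integers : Type := Integers {
  int_val : K;
  int_valP : int_val \in integral_pred
}.

HB.instance Definition _ := [isSub for int_val].
HB.instance Definition _ := [Choice of integers by <:].
HB.instance Definition _ := [SubChoice_isSubComNzRing of integers by <:].

Lemma W_to_integers_subproof (w : W) : W_to_K w \in integral_pred.
Proof. exact/asboolP/integral_id. Qed.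

Definition W_to_integers (w : W) : integers :=
  Integers (W_to_integers_subproof w).

End RingOfIntegers.

(* Fields containing both the complex numbers and K serve to compare complex
   representations with representations over K. *)
Definition complex_irr_realisable (R : realType) (K : fieldType)
    (gT : finGroupType) (G : {group gT}) : Prop :=
  exists (E : fieldType) (c : {rmorphism R[i] -> E}) (j : {rmorphism K -> E}),
    forall n (r : mx_representation R[i] G n), mx_irreducible r ->
    exists s : mx_representation K G n, mx_rsim (map_repr c r) (map_repr j s).

(* As the ring of integers of K is local, a surjective morphism onto a field
   is the reduction modulo its maximal ideal. *)
Record is_residue_field (Fq : finFieldType) (W : idomainType)
    (redW : {rmorphism W -> Fq}) (K : fieldExtType {fraction W})
    (k : fieldType) (redK : {rmorphism integers K -> k})
    (iota : {rmorphism Fq -> k}) : Prop := IsResidueField {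
  residue_surj : forall a : k, exists x : integers K, redK x = a;
  residue_compat : forall w : W, redK (W_to_integers K w) = iota (redW w)
}.

Section PlaneCurve.

Variables (k L : fieldType) (emb : {rmorphism k -> L}).

Definition eval_at (xi : 'cV[L]_3) (P : {mpoly k[3]}) : L :=
  (map_mpoly emb P).@[fun i => xi i 0].

(* L is the function field of the integral curve F = 0 in P^2 over k, and xi
   its generic point: the homogeneous ideal of xi is generated by F, and L is
   the field of the quotients of forms of equal degree at xi. *)
Record is_function_field (F : {mpoly k[3]}) (xi : 'cV[L]_3) : Prop :=
  IsFunctionField {
    generic_vanishing : forall n (P : {mpoly k[3]}), P \is n.-homog ->
      eval_at xi P = 0 <-> exists Q, P = Q * F;
    generic_fractions : forall f : L, exists n (A B : {mpoly k[3]}),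
      [/\ A \is n.-homog, B \is n.-homog, eval_at xi B != 0
        & f = eval_at xi A / eval_at xi B]
  }.

(* The coordinate ring of the affine chart X_i <> 0, inside the function
   field. *)
Definition chart_ring (xi : 'cV[L]_3) (i : 'I_3) (f : L) : Prop :=
  exists n (A : {mpoly k[3]}), A \is n.-homog /\ f = eval_at xi A / xi i 0 ^+ n.

Definition derivation (M : lmodType L) (D : L -> M) : Prop :=
  [/\ forall f g, D (f + g) = D f + D g,
      forall f g, D (f * g) = f *: D g + g *: D f
    & forall c : k, D (emb c) = 0].

Record is_kahler (Omega : lmodType L) (d : L -> Omega) : Prop := IsKahler {
  kahler_derivation : derivation d;
  kahler_universal : forall (M : lmodType L) (D : L -> M), derivation D ->
    exists2 u : {linear Omega -> M}, (forall f, u (d f) = D f)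
      & forall v : {linear Omega -> M}, (forall f, v (d f) = D f) -> u =1 v
}.

Variables (Omega : lmodType L) (d : L -> Omega).

(* The sections of the sheaf of differentials over the affine open with
   coordinate ring A, seen as rational differential forms. *)
Definition regular_over (A : L -> Prop) (w : Omega) : Prop :=
  exists s : seq (L * L),
    (forall fg, fg \in s -> A fg.1 /\ A fg.2)
    /\ w = \sum_(fg <- s) fg.1 *: d fg.2.

Definition holomorphic_form (xi : 'cV[L]_3) (w : Omega) : Prop :=
  forall i : 'I_3, regular_over (chart_ring xi i) w.

(* The kG-module H, a subspace of Omega with the action act, is afforded by
   the matrix representation r; in particular it is finitely generated. *)
Definition affords (gT : finGroupType) (G : {group gT})
    (act : gT -> Omega -> Omega) (H : Omega -> Prop) n
    (r : mx_representation k G n) : Prop :=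
  exists phi : 'cV[k]_n -> Omega,
    [/\ forall a u v, phi (a *: u + v) = emb a *: phi u + phi v,
        injective phi,
        forall w, H w <-> exists v, w = phi v
      & forall g v, g \in G -> phi (r g *m v) = act g (phi v)].

End PlaneCurve.

Definition drinfeld_form (Fq : finFieldType) (q : nat) : {mpoly Fq[3]} :=
  'X_0 * 'X_1 ^+ q - 'X_0 ^+ q * 'X_1 - 'X_2%R ^+ q.+1.

Section DrinfeldAction.

Variables (Fq : finFieldType) (k L : fieldType).
Variables (iota : {rmorphism Fq -> k}) (emb : {rmorphism k -> L}).

Definition coord_mx (g : {'GL_2[Fq]}) : 'M[k]_3 :=
  block_mx (natural_mx iota g) 0 0 (1%:M : 'M_1).

Definition act_point (g : {'GL_2[Fq]}) (xi : 'cV[L]_3) : 'cV[L]_3 :=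
  map_mx emb (coord_mx g) *m xi.

(* The left action on rational functions, (g . f)(x) = f(g^-1 x). *)
Definition induced_on_functions (xi : 'cV[L]_3)
    (sigma : {'GL_2[Fq]} -> {rmorphism L -> L}) : Prop :=
  forall g, g \in SL2 Fq ->
    (forall c : k, sigma g (emb c) = emb c)
    /\ forall i j, let eta := act_point g^-1%g xi in
         sigma g (xi i 0 / xi j 0) = eta i 0 / eta j 0.

Definition induced_on_forms (Omega : lmodType L) (d : L -> Omega)
    (sigma : {'GL_2[Fq]} -> {rmorphism L -> L})
    (act : {'GL_2[Fq]} -> Omega -> Omega) : Prop :=
  forall g, g \in SL2 Fq ->
    (forall w w', act g (w + w') = act g w + act g w')
    /\ forall f h, act g (f *: d h) = sigma g f *: d (sigma g h).

End DrinfeldAction.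

(* Main.v *)
Require Import Defs.
From HB Require Import structures.
From mathcomp Require Import all_boot all_order all_algebra all_fingroup.
From mathcomp Require Import all_field all_character.
From mathcomp Require Import ring_quotient fraction.
From mathcomp Require Import boolp reals.
From mathcomp.real_closed Require Import complex.
From mathcomp.multinomials Require Import freeg mpoly.
From mathcomp Require Import ring.

(* In the affine coordinates x = X/Z, y = Y/Z the curve is x y^q - x^q y = 1,
   and omega = x dy - y dx satisfies dx = x^q omega and dy = y^q omega, so it
   generates the differentials on the chart Z <> 0.  On the charts X <> 0 and
   Y <> 0 they are generated by d(1/x) = - x^(q-2) omega and
   d(1/y) = - y^(q-2) omega; since X^T and Y^T form a regular sequence on the
   homogeneous coordinate ring, the holomorphic forms are exactly the P(x, y) omega
   with P a polynomial of degree at most q-2.  As omega is SL_2-invariant and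
   (y, -x) transforms like the standard basis, this space is the direct sum
   of the V_i for i <= q-2. *)

Set Implicit Arguments.
Unset Strict Implicit.
Unset Printing Implicit Defensive.

Import GRing.Theory.
Local Open Scope ring_scope.

(** The bound q-2 is the one of adjunction: a plane curve of degree q+1 has canonical sheaf O(q-2).
    The charts X and Y already cover the curve, because X = Y = 0 forces Z = 0; this is why
    comparing a form on these two charts bounds its degree. The obstacle is that [L] is known only
    through the homogeneous ideal of its generic point, and [Omega] only through its universal
    property. Equality in [L] is therefore decided by normal forms, in which Z has degree at most q;
    a form of degree q-2 is its own normal form, so polynomials in x, y of degree at most q-2
    satisfy no relation. That omega is nonzero needs an actual derivation of [L], built by hand from
    the equation and then fed to the universal property. *)

Section GrothendieckGroup.

Variables (k : fieldType) (gT : finGroupType) (G : {group gT}).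

Lemma G0_class_exact n1 n n2 (r1 : mx_representation k G n1)
    (r : mx_representation k G n) (r2 : mx_representation k G n2) :
  short_exact r1 r r2 -> G0_class r = G0_class r1 + G0_class r2.
Proof.
move=> ex; rewrite /G0_class -raddfD /=; apply/eqP.
rewrite -Quotient.idealrBE opprD addrA; apply/asboolP => S _; exact.
Qed.

(** The zero module is an extension of itself by itself, so its class equals its own double. *)
Lemma G0_class_dim0 (r : mx_representation k G 0) : G0_class r = 0.
Proof.
have ex : short_exact r r r.
  exists 0, 0; split=> [||u _|w|v]; try by move=> g _; rewrite !mul0mx !mulmx0.
  - by apply/matrixP => [[]].
  - by exists w; apply/matrixP => [[]].
  - by split=> [_|_]; [exists v|]; apply/matrixP => [[]].
by apply: (addrI (G0_class r)); rewrite addr0 -(G0_class_exact ex).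
Qed.

Section DirectSum.

Variables (m n : nat) (r : mx_representation k G m).
Variable s : mx_representation k G n.

Lemma dsum_mx_repr : mx_repr G (fun g => block_mx (r g) 0 0 (s g)).
Proof.
split=> [|g h Gg Gh]; first by rewrite !repr_mx1 -scalar_mx_block.
by rewrite mulmx_block !mulmx0 !mul0mx !addr0 add0r !repr_mxM.
Qed.

Definition dsum_repr : mx_representation k G (m + n) :=
  MxRepresentation dsum_mx_repr.

Lemma G0_class_dsum : G0_class dsum_repr = G0_class r + G0_class s.
Proof.
apply: G0_class_exact; exists (col_mx 1%:M 0), (row_mx 0 1%:M).
split=> [g _|g _|u|w|v].
- by rewrite /= mul_block_col mul_col_mx !mulmx0 !mul0mx mulmx1 mul1mx !addr0.
- by rewrite /= mul_row_block mul_mx_row !mulmx0 !mul0mx mulmx1 mul1mx !add0r.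
- rewrite mul_col_mx mul1mx => /(congr1 usubmx).
  by rewrite col_mxKu linear0.
- by exists (col_mx 0 w); rewrite mul_row_col mul0mx mul1mx add0r.
- rewrite -[v in _ *m v = _]vsubmxK mul_row_col mul0mx add0r mul1mx; split=> [v0|[u ->]].
    by exists (usubmx v); rewrite mul_col_mx mul1mx mul0mx -v0 vsubmxK.
  by rewrite mul_col_mx mul0mx col_mxKd.
Qed.

End DirectSum.

End GrothendieckGroup.

(** * Binary polynomials of bounded degree as a sum of symmetric powers *)

Section PolynomialsOfBoundedDegree.

Variables (k : fieldType) (Fq : finFieldType) (iota : {rmorphism Fq -> k}).

Definition sym_vec i (v : 'cV[k]_i.+1) : {mpoly k[2]} :=
  \sum_l v l 0 *: 'X_[sym_mon l].

Lemma sym_vec_linear i : linear (@sym_vec i).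
Proof.
move=> a u v; rewrite /sym_vec scaler_sumr -big_split /=.
by apply: eq_bigr => l _; rewrite !mxE scalerDl scalerA.
Qed.

Lemma sym_vec_homog i (v : 'cV[k]_i.+1) : sym_vec v \is i.-homog.
Proof.
apply: rpred_sum => l _; apply: rpredZ.
by rewrite dhomogX /= mdeg_sym_mon.
Qed.

Lemma sym_vec_coeff i (v : 'cV[k]_i.+1) l : (sym_vec v)@_(sym_mon l) = v l 0.
Proof.
rewrite raddf_sum (bigD1 l) //= mcoeffZ mcoeffX eqxx mulr1 big1 ?addr0 // => j nj.
by rewrite mcoeffZ mcoeffX (inj_eq (@sym_mon_inj i)) (negPf nj) mulr0.
Qed.

Lemma sym_vec_act i A (v : 'cV[k]_i.+1) :
  sym_vec (sym_mx i A *m v) = sym_act A (sym_vec v).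
Proof.
rewrite [RHS](sym_homogE (sym_act_homog A (sym_vec_homog v))).
apply: eq_bigr => l _; congr (_ *: _); rewrite mxE sym_act_sum raddf_sum.
by apply: eq_bigr => j _; rewrite /= mcoeffZ !mxE mulrC.
Qed.

Lemma msize_sym_vec i (v : 'cV[k]_i.+1) : (msize (sym_vec v) <= i.+1)%N.
Proof.
rewrite msizeE; apply/bigmax_leqP_seq => m mP _.
by have /dhomogP -> := sym_vec_homog v.
Qed.

(** As [msize] is the degree plus one, passing from [m] to [m.+1] adjoins the homogeneous part of
    degree [m]. Linear substitutions preserve degrees, so this part splits off as a direct
    summand. *)
Lemma bounded_degree_repr m :
  exists n (r : mx_representation k (SL2_group Fq) n)
      (phi : 'cV[k]_n -> {mpoly k[2]}),
    [/\ linear phi, injective phi,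
        forall P, (msize P <= m)%N <-> exists v, P = phi v,
        forall g v, g \in SL2_group Fq ->
          phi (r g *m v) = sym_act (natural_mx iota g) (phi v)
      & G0_class r = \sum_(i < m) G0_class (sym_repr iota i)].
Proof.
elim: m => [|m [n [r [phi [phi_lin phi_inj phi_im phi_act r_class]]]]].
  have r0 : mx_repr (SL2_group Fq) (fun _ => 1%:M : 'M[k]_0).
    by split=> // g h _ _; rewrite mulmx1.
  exists 0, (MxRepresentation r0), (fun=> 0); split.
  - by move=> a u v; rewrite scaler0 addr0.
  - by move=> u v _; apply/matrixP => [[]].
  - move=> P; rewrite leqn0 msize_poly_eq0; split=> [/eqP->|[_ ->]] //.
    by exists 0.
  - by move=> g v _; rewrite /sym_act raddf0.
  - by rewrite big_ord0 G0_class_dim0.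
have phi_msize u : (msize (phi u) <= m)%N by apply/phi_im; exists u.
exists (n + m.+1)%N, (dsum_repr r (sym_repr iota m)).
exists (fun v => phi (usubmx v) + sym_vec (dsubmx v)); split.
- move=> a u v; rewrite !linearP phi_lin sym_vec_linear scalerDr.
  by rewrite addrACA.
- move=> u v /= uv; rewrite -[u]vsubmxK -[v]vsubmxK.
  (* In degree [m] only the [sym_vec] summand has coefficients, so it can be read off and
     cancelled. *)
  have dE : dsubmx u = dsubmx v.
    apply/colP => l; rewrite -!sym_vec_coeff.
    have := congr1 (mcoeff (sym_mon l)) uv; rewrite !mcoeffD.
    rewrite !(@memN_msupp_eq0 _ _ (phi _) (sym_mon l)) ?add0r //;
      by apply: msize_mdeg_ge; rewrite mdeg_sym_mon.
  by congr col_mx => //; apply: phi_inj; move: uv; rewrite dE => /addIr.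
- move=> P; split=> [sP|[v ->]]; last first.
    apply: leq_trans (msizeD_le _ _) _; rewrite geq_max msize_sym_vec andbT.
    exact: leqW.
  (* The component of degree [m] of [P]; subtracting it leaves a polynomial in the image of
     [phi]. *)
  pose v : 'cV[k]_m.+1 := \col_l P@_(sym_mon l).
  have /phi_im [u uE] : (msize (P - sym_vec v) <= m)%N.
    rewrite msizeE; apply/bigmax_leqP_seq => w.
    rewrite mcoeff_msupp mcoeffB => wP _.
    have : (mdeg w <= m)%N.
      rewrite -ltnS; apply: contraR wP; rewrite -leqNgt => wm.
      rewrite !memN_msupp_eq0 ?subrr //; apply: msize_mdeg_ge.
        exact: leq_trans (msize_sym_vec v) _.
      exact: leq_trans sP _.
    rewrite leq_eqVlt => /orP [/eqP wm|//].
    case/eqP: wP; have [l ->] := sym_monP wm.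
    by rewrite sym_vec_coeff mxE subrr.
  by exists (col_mx u v); rewrite col_mxKu col_mxKd -uE subrK.
- move=> g v Gg; rewrite /= -{1 2}[v]vsubmxK mul_block_col !mul0mx addr0 add0r.
  rewrite col_mxKu col_mxKd phi_act // sym_vec_act.
  by rewrite /sym_act raddfD.
- by rewrite G0_class_dsum r_class big_ord_recr.
Qed.

End PolynomialsOfBoundedDegree.

Lemma ord3_neq2 (i : 'I_3) : i != 2%R -> i = 0 \/ i = 1.
Proof.
by case: i => [[|[|[|//]]] lti] // _; [left|right]; apply: val_inj.
Qed.

(** * Evaluation of ternary forms at a point over [L] *)

Section Evaluation.

Variables (k L : fieldType) (emb : {rmorphism k -> L}) (v : 'cV[L]_3).

Lemma eval_at_zmod_morphism : zmod_morphism (eval_at emb v).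
Proof. by move=> P Q; rewrite /eval_at !raddfB. Qed.

Lemma eval_at_monoid_morphism : monoid_morphism (eval_at emb v).
Proof. by rewrite /eval_at; split=> [|P Q]; rewrite ?rmorph1 // !rmorphM. Qed.

HB.instance Definition _ := GRing.isZmodMorphism.Build
  {mpoly k[3]} L (eval_at emb v) eval_at_zmod_morphism.
HB.instance Definition _ := GRing.isMonoidMorphism.Build
  {mpoly k[3]} L (eval_at emb v) eval_at_monoid_morphism.

Lemma eval_atC c : eval_at emb v c%:MP = emb c.
Proof. by rewrite /eval_at map_mpolyC mevalC. Qed.

Lemma eval_atZ c P : eval_at emb v (c *: P) = emb c * eval_at emb v P.
Proof. by rewrite -mul_mpolyC rmorphM /= eval_atC. Qed.

Lemma eval_atX i : eval_at emb v 'X_i = v i 0.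
Proof. by rewrite /eval_at map_mpolyX mevalXU. Qed.

Lemma eval_atXm m : eval_at emb v 'X_[m] = \prod_i v i 0 ^+ m i.
Proof. by rewrite /eval_at map_mpolyX mevalX. Qed.

Lemma eval_at_ind (S : L -> Prop) :
    (forall c, S (emb c)) -> (forall i, S (v i 0)) ->
    (forall a b, S a -> S b -> S (a + b)) ->
    (forall a b, S a -> S b -> S (a * b)) ->
  forall P, S (eval_at emb v P).
Proof.
move=> SC Sv SD SM P; have S0 : S 0 by rewrite -(rmorph0 emb).
have S1 : S 1 by rewrite -(rmorph1 emb).
rewrite [P]mpolyE raddf_sum; apply: big_ind => // m _ /=.
rewrite eval_atZ; apply: (SM _ _ (SC _)); rewrite eval_atXm.
apply: big_ind => // i _; elim: (m i) => [|n IHn]; first by rewrite expr0.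
by rewrite exprS; apply: SM.
Qed.

End Evaluation.

#[local] Opaque eval_at.

Lemma eval_at_scale (k L : fieldType) (emb : {rmorphism k -> L}) (t : L)
    (v : 'cV[L]_3) n P : P \is n.-homog ->
  eval_at emb (t *: v) P = t ^+ n * eval_at emb v P.
Proof.
move=> /dhomogP homP; rewrite [P in LHS]mpolyE [P in RHS]mpolyE !raddf_sum.
rewrite mulr_sumr; apply: eq_big_seq => m /homP <- /=.
rewrite !eval_atZ mulrCA; congr (_ * _); rewrite !eval_atXm /= mdegE.
by rewrite -prodrXr -big_split; apply: eq_bigr => i _; rewrite mxE exprMn.
Qed.

Lemma mcoeffMX_if n (R : nzRingType) (P : {mpoly R[n]}) a m :
  (P * 'X_[a])@_m = if (a <= m)%MM then P@_(m - a) else 0.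
Proof.
case: ifP => [am|nam]; first by rewrite -[in LHS](submK am) addmC mcoeffMX.
apply: memN_msupp_eq0; rewrite (perm_mem (msuppMX _ _)).
by apply/mapP => -[w _ mE]; rewrite mE lem_addr in nam.
Qed.

(** * The quotient rule and derivations of a field *)

Section QuotientRule.

Variable L : fieldType.
Implicit Types a b : L.

(** Here [da] and [db] are plain scalars: numerators and denominators will be values of forms, on
    which the derivation exists only before evaluation. *)
Definition quotient_rule a da b db := (da * b - a * db) / b ^+ 2.

Lemma quotient_rule_unique a da b db a' da' b' db' : b != 0 -> b' != 0 ->
    a * b' = a' * b -> da * b' + a * db' = da' * b + a' * db ->
  quotient_rule a da b db = quotient_rule a' da' b' db'.
Proof.
move=> b0 b'0 ab dab; have a'E : a' = a * b' / b by rewrite ab mulfK.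
have da'E : da' = (da * b' + a * db' - a' * db) / b by rewrite dab addrK mulfK.
by rewrite /quotient_rule da'E a'E; field; rewrite b0 b'0.
Qed.

Lemma quotient_ruleD a da b db a' da' b' db' : b != 0 -> b' != 0 ->
  quotient_rule (a * b' + a' * b) (da * b' + a * db' + (da' * b + a' * db))
      (b * b') (db * b' + b * db')
    = quotient_rule a da b db + quotient_rule a' da' b' db'.
Proof. by move=> b0 b'0; rewrite /quotient_rule; field; rewrite b0 b'0. Qed.

Lemma quotient_ruleM a da b db a' da' b' db' : b != 0 -> b' != 0 ->
  quotient_rule (a * a') (da * a' + a * da') (b * b') (db * b' + b * db')
    = a / b * quotient_rule a' da' b' db' + a' / b' * quotient_rule a da b db.
Proof. by move=> b0 b'0; rewrite /quotient_rule; field; rewrite b0 b'0. Qed.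

End QuotientRule.

Section Derivations.

Variables (k L : fieldType) (emb : {rmorphism k -> L}) (M : lmodType L).
Variable D : L -> M.
Hypothesis D_der : derivation emb D.

Lemma derivation1 : D 1 = 0.
Proof. by case: D_der => _ _ D0; rewrite -(rmorph1 emb) D0. Qed.

Lemma derivationN f : D (- f) = - D f.
Proof.
case: D_der => DD _ D0; apply/eqP; rewrite -addr_eq0 addrC -DD subrr.
by rewrite -(rmorph0 emb) D0.
Qed.

Lemma derivationXn f n : D (f ^+ n.+1) = (n.+1%:R * f ^+ n) *: D f.
Proof.
case: D_der => _ DM _; elim: n => [|n IHn]; first by rewrite mulr1 scale1r.
rewrite exprS DM IHn scalerA -scalerDl; congr (_ *: _).
by rewrite -[in RHS]natr1 exprS; ring.
Qed.

Lemma derivationV f : f != 0 -> D f^-1 = - (f ^+ 2)^-1 *: D f.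
Proof.
move=> f0; case: D_der => _ DM _.
have /eqP := DM f f^-1; rewrite divff // derivation1 eq_sym addr_eq0 => /eqP fD.
rewrite -[LHS]scale1r -(mulVf f0) -scalerA fD scalerN scalerA scaleNr.
by congr (- (_ *: _)); field.
Qed.

End Derivations.

(** * The Drinfeld curve: normal forms, function field and derivation *)

Section DrinfeldCurve.

Variables (k L : fieldType) (emb : {rmorphism k -> L}) (q : nat).

Definition drinfeld_poly : {mpoly k[3]} :=
  'X_0 * 'X_1 ^+ q - 'X_0 ^+ q * 'X_1 - 'X_2%R ^+ q.+1.

Variable xi : 'cV[L]_3.
Hypotheses (q_gt1 : (1 < q)%N) (q_char : q%:R = 0 :> k).
Hypothesis L_function_field : is_function_field emb drinfeld_poly xi.

Local Notation ev := (eval_at emb xi).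

Lemma ev_homog_eq0 n P : P \is n.-homog ->
  ev P = 0 <-> exists Q, P = Q * drinfeld_poly.
Proof. exact: (generic_vanishing L_function_field). Qed.

Lemma drinfeld_poly_homog : drinfeld_poly \is q.+1.-homog.
Proof.
have homX i : 'X_i \is [in k[3], 1.-homog] by rewrite dhomogX /= mdeg1.
have homXn i n : 'X_i ^+ n \is [in k[3], n.-homog].
  by rewrite -[X in X.-homog]mul1n dhomogMn.
rewrite /drinfeld_poly rpredB ?rpredB //; first exact: dhomogM (homX _) (homXn _ _).
by have := dhomogM (homXn 0 q) (homX 1); rewrite addn1.
Qed.

Lemma ev_drinfeld : ev drinfeld_poly = 0.
Proof. by apply/(ev_homog_eq0 drinfeld_poly_homog); exists 1; rewrite mul1r. Qed.

Lemma xi_eq : xi 0 0 * xi 1 0 ^+ q - xi 0 0 ^+ q * xi 1 0 = xi 2%R 0 ^+ q.+1.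
Proof.
apply/eqP; rewrite -subr_eq0 -[X in _ == X]ev_drinfeld; apply/eqP.
by rewrite !rmorphB !rmorphM !rmorphXn /= !eval_atX.
Qed.

(* On the curve, a form has a unique representative of degree at most q in
   the third variable, since the equation is monic in it up to sign. *)
Definition reduced n (P : {mpoly k[3]}) : Prop :=
  forall m, P@_m != 0 -> mdeg m = n /\ (m 2%R <= q)%N.

Lemma reduced_homog n P : reduced n P -> P \is n.-homog.
Proof. by move=> rP; apply/dhomogP => m; rewrite mcoeff_msupp => /rP []. Qed.

Lemma reduced0 n : reduced n 0.
Proof. by move=> m; rewrite mcoeff0 eqxx. Qed.

Lemma reducedD n P Q : reduced n P -> reduced n Q -> reduced n (P + Q).
Proof.
move=> rP rQ m; rewrite mcoeffD.
by have [->|/rP //] := eqVneq P@_m 0; rewrite add0r => /rQ.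
Qed.

Lemma reducedZ n c P : reduced n P -> reduced n (c *: P).
Proof.
by move=> rP m; rewrite mcoeffZ mulf_eq0 negb_or => /andP [_ /rP].
Qed.

Lemma reducedX (m : 'X_{1..3}) : (m 2%R <= q)%N -> reduced (mdeg m) 'X_[m].
Proof. by move=> mq w; rewrite mcoeffX; have [<-|_] := eqVneq m w; rewrite ?eqxx. Qed.

(** Replacing Z^(q+1) by X Y^q - X^q Y keeps the total degree and lowers the exponent of Z by q+1,
    whence the induction on that exponent. *)
Lemma ev_reducedX (m : 'X_{1..3}) : exists2 P, reduced (mdeg m) P & ev 'X_[m] = ev P.
Proof.
have [c] := ubnP (m 2%R); elim: c => // c IHc in m *; rewrite ltnS => mc.
have [mq|qm] := leqP (m 2%R) q; first by exists 'X_[m] => //; apply: reducedX.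
pose z := (U_(2%R : 'I_3) *+ q.+1)%MM.
have zm : (z <= m)%MM.
  apply/mnm_lepP => i; rewrite mulmnE mnm1E.
  by have [<-|_] := eqVneq (2%R : 'I_3) i; rewrite ?mul1n ?mul0n.
pose a := (U_(0%R : 'I_3) + U_(1%R) *+ q)%MM.
pose b := (U_(0%R : 'I_3) *+ q + U_(1%R))%MM.
have ab2 : a 2%R = 0 /\ b 2%R = 0 by rewrite !mnmDE !mulmnE !mnm1E /= !mul0n.
have mz2 : ((m - z)%MM 2%R < c)%N.
  rewrite mnmBE mulmnE mnm1E eqxx mul1n; apply: leq_trans mc.
  by rewrite ltn_subrL /= (leq_ltn_trans _ qm).
have dmz : mdeg m = (mdeg (m - z) + q.+1)%N.
  by rewrite -[in LHS](submK zm) mdegD mdegMn mdeg1 mul1n.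
have [|P rP evP] := IHc (m - z + a)%MM; first by rewrite mnmDE ab2.1 addn0.
have [|Q rQ evQ] := IHc (m - z + b)%MM; first by rewrite mnmDE ab2.2 addn0.
exists (P + (-1) *: Q).
  have dE : mdeg m = mdeg (m - z + a) /\ mdeg m = mdeg (m - z + b).
    rewrite dmz !mdegD !mdegMn !mdeg1 !mul1n; split; congr (_ + _)%N.
    by rewrite addn1.
  by apply: reducedD; [rewrite dE.1|apply: reducedZ; rewrite dE.2].
rewrite rmorphD /= eval_atZ rmorphN1 mulN1r -evP -evQ -[in LHS](submK zm).
rewrite !mpolyXD !rmorphM /= -mulrBr; congr (_ * _).
by rewrite -!mpolyXn !rmorphXn /= !eval_atX xi_eq.
Qed.

Lemma ev_reduced n P : P \is n.-homog ->
  exists2 Q, reduced n Q & ev P = ev Q.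
Proof.
move=> /dhomogP homP; rewrite [P]mpolyE raddf_sum big_seq.
apply: (big_ind (fun a => exists2 Q, reduced n Q & a = ev Q)).
- by exists 0; [apply: reduced0|rewrite raddf0].
- move=> _ _ [Q rQ ->] [Q' rQ' ->]; exists (Q + Q'); last by rewrite raddfD.
  exact: reducedD.
- move=> m /homP <- /=; have [Q rQ evQ] := ev_reducedX m.
  by exists (P@_m *: Q); [apply: reducedZ|rewrite !eval_atZ evQ].
Qed.

(** This is uniqueness in the division by a polynomial monic in Z up to sign. If [P] is [Q] times
    the equation, the coefficient of [P] at Z^(q+1) times a monomial vanishes, and it expresses the
    coefficient of [Q] at that monomial through coefficients of [Q] with higher powers of Z.
    Descending induction on the exponent of Z applies, as exponents from [msize Q] on do not
    occur. *)
Lemma reduced_ev_eq0 n P : reduced n P -> ev P = 0 -> P = 0.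
Proof.
move=> rP /(ev_homog_eq0 (reduced_homog rP)) [Q PE].
suff Q0 m : Q@_m = 0.
  by rewrite PE (_ : Q = 0) ?mul0r //; apply/mpolyP => m; rewrite Q0 mcoeff0.
have [c] := ubnP (msize Q - m 2%R)%N; elim: c => // c IHc in m *.
rewrite ltnS => mc; have [Qm|mQ] := leqP (msize Q) (m 2%R).
  apply: memN_msupp_eq0; apply: msize_mdeg_ge; apply: leq_trans Qm _.
  by rewrite mdegE (bigD1 (2%R : 'I_3)) //= leq_addr.
pose z := (U_(2%R : 'I_3) *+ q.+1)%MM.
have Qa0 (a : 'X_{1..3}) : a 2%R = 0 -> (Q * 'X_[a])@_(z + m) = 0.
  move=> a2; rewrite mcoeffMX_if; case: ifP => // am; apply: IHc.
  apply: leq_trans mc; rewrite mnmBE mnmDE mulmnE mnm1E eqxx mul1n a2 subn0.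
  by rewrite ltn_sub2l // addSn ltnS leq_addl.
have : P@_(z + m) = 0.
  apply: contraTeq isT => /rP [_]; rewrite mnmDE mulmnE mnm1E eqxx mul1n.
  by rewrite addSn ltnNge leq_addr.
rewrite PE /drinfeld_poly !mulrBr !mpolyXn -!mpolyXD !mcoeffB.
rewrite (Qa0 (U_(0%R : 'I_3) + U_(1%R) *+ q)%MM) ?mnmDE ?mulmnE ?mnm1E //.
rewrite (Qa0 (U_(0%R : 'I_3) *+ q + U_(1%R))%MM) ?mnmDE ?mulmnE ?mnm1E //.
by rewrite mcoeffMX subr0 sub0r => /eqP; rewrite oppr_eq0 => /eqP.
Qed.

Lemma xi_neq0 i : xi i 0 != 0.
Proof.
apply/eqP => xi0; have rX : reduced (mdeg U_(i)) ('X_i : {mpoly k[3]}).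
  apply: reducedX; rewrite mnm1E; case: (_ == _) => //.
  exact: leq_trans q_gt1.
have /mpolyP/(_ U_(i)%MM) : 'X_i = 0 :> {mpoly k[3]}.
  by apply: (reduced_ev_eq0 rX); rewrite eval_atX.
by rewrite mcoeffX eqxx mcoeff0 => /eqP; rewrite oner_eq0.
Qed.

(* X^T and Y^T form a regular sequence on the homogeneous coordinate ring. *)
Lemma ev_glue T n A B : A \is (T + n).-homog -> B \is (T + n).-homog ->
    xi 0 0 ^+ T * ev B = xi 1 0 ^+ T * ev A ->
  exists2 P, reduced n P & ev B = xi 1 0 ^+ T * ev P.
Proof.
move=> /ev_reduced [A' rA ->] /ev_reduced [B' rB ->] AB.
pose a := (U_(0%R : 'I_3) *+ T)%MM; pose b := (U_(1%R : 'I_3) *+ T)%MM.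
have ab2 : a 2%R = 0 /\ b 2%R = 0 by rewrite !mulmnE !mnm1E.
(* Powers of X and Y do not change the exponent of Z, so both products stay in normal form and the
   relation on the curve lifts to an identity of polynomials. *)
have redM (c : 'X_{1..3}) P : c 2%R = 0 -> mdeg c = T -> reduced (T + n) P ->
    reduced (T + (T + n)) (P * 'X_[c]).
  move=> c2 dc rP m; rewrite mcoeffMX_if; case: ifP => [cm|]; last by rewrite eqxx.
  move=> /rP; rewrite mnmBE c2 subn0 => -[dm m2]; split=> //.
  by rewrite -(submK cm) mdegD dm dc addnC.
have /(congr1 (fun P => P + A' * 'X_[b])) : B' * 'X_[a] + (-1) *: (A' * 'X_[b]) = 0.
  have dT i : mdeg (U_(i : 'I_3) *+ T) = T by rewrite mdegMn mdeg1 mul1n.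
  apply: (@reduced_ev_eq0 (T + (T + n))).
    apply: reducedD; first exact: redM ab2.1 (dT _) rB.
    apply: reducedZ; exact: redM ab2.2 (dT _) rA.
  rewrite rmorphD /= eval_atZ rmorphN1 mulN1r !rmorphM /= -!mpolyXn.
  by rewrite !rmorphXn /= !eval_atX mulrC AB mulrC subrr.
rewrite scaleN1r subrK add0r => ABE.
(* Multiplication by X^T leaves the exponent of Y alone, so Y^T divides each monomial of [B']. *)
have bB m : m \in msupp B' -> (b <= m)%MM.
  move=> mB; apply/mnm_lepP => i; rewrite mulmnE mnm1E.
  have [<-|_] := eqVneq (1%R : 'I_3) i; last by rewrite mul0n.
  rewrite mul1n; move: mB; rewrite mcoeff_msupp -(mcoeffMX B' a m) ABE mcoeffMX_if.
  case: ifP => [/mnm_lepP/(_ 1%R)|_]; last by rewrite eqxx.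
  by rewrite mnmDE !mulmnE !mnm1E eqxx mul1n mul0n add0n.
pose P := \sum_(m <- msupp B') B'@_m *: 'X_[m - b] : {mpoly k[3]}.
have BE : B' = P * 'X_[b].
  rewrite [LHS]mpolyE mulr_suml; apply: eq_big_seq => m mB.
  by rewrite -scalerAl -mpolyXD submK // bB.
exists P.
  move=> m; rewrite -(mcoeffMX P b) -BE => /rB.
  rewrite mnmDE ab2.2 add0n mdegD mdegMn mdeg1 mul1n => -[/eqP].
  by rewrite eqn_add2l => /eqP.
by rewrite BE rmorphM /= -mpolyXn rmorphXn /= eval_atX mulrC.
Qed.

Local Notation z i := (xi i 0 / xi 2%R 0).

Let Z_neq0 : xi 2%R 0 != 0 := xi_neq0 2%R.

Let z_neq0 i : z i != 0.
Proof. by rewrite mulf_neq0 ?invr_eq0 ?xi_neq0. Qed.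

Let q_charL : q%:R = 0 :> L.
Proof. by rewrite -(rmorph_nat emb) q_char rmorph0. Qed.

Lemma affine_eq : z 0 * z 1 ^+ q - z 0 ^+ q * z 1 = 1.
Proof.
rewrite !expr_div_n !mulf_div -exprS -exprSr -mulrBl xi_eq divff //.
by rewrite expf_neq0.
Qed.

(* The derivation X^q d/dX + Y^q d/dY kills the equation of the curve, hence
   descends to its function field. *)
Definition polar (P : {mpoly k[3]}) : L :=
  xi 0 0 ^+ q * ev P^`M(0) + xi 1 0 ^+ q * ev P^`M(1).

Lemma polarD P Q : polar (P + Q) = polar P + polar Q.
Proof. by rewrite /polar !mderivD !(raddfD (eval_at emb xi)) !mulrDr addrACA. Qed.

Lemma polarB P Q : polar (P - Q) = polar P - polar Q.
Proof. by rewrite /polar !mderivB !rmorphB /= !mulrBr opprD addrACA. Qed.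

Lemma polarM P Q : polar (P * Q) = polar P * ev Q + ev P * polar Q.
Proof.
have evM i : ev (P * Q)^`M(i) = ev P^`M(i) * ev Q + ev P * ev Q^`M(i).
  by rewrite mderivM (raddfD (eval_at emb xi)) /= !(rmorphM (eval_at emb xi)).
rewrite /polar !evM.
suff leibniz (x y a a0 a1 b b0 b1 : L) :
    x * (a0 * b + a * b0) + y * (a1 * b + a * b1)
      = (x * a0 + y * a1) * b + a * (x * b0 + y * b1) by exact: leibniz.
by ring.
Qed.

Lemma polarC c : polar c%:MP = 0.
Proof. by rewrite /polar !mderivC !rmorph0 !mulr0 addr0. Qed.

Lemma polarXn P n : polar (P ^+ n.+1) = n.+1%:R * ev P ^+ n * polar P.
Proof.
elim: n => [|n IHn]; first by rewrite expr0 !mul1r.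
by rewrite exprS polarM IHn rmorphXn /= -[in RHS]natr1 exprS; ring.
Qed.

Lemma polarXq P : polar (P ^+ q) = 0.
Proof.
have q_gt0 := ltnW q_gt1.
by rewrite -[in LHS](prednK q_gt0) polarXn (prednK q_gt0) q_charL !mul0r.
Qed.

Lemma polarX i : polar 'X_i = if i == 2%R then 0 else xi i 0 ^+ q.
Proof.
rewrite /polar !mderivX !mnm1E !eval_atZ.
have subUU : (U_(i : 'I_3) - U_(i))%MM = 0%MM.
  by apply/mnmP => j; rewrite mnmBE subnn mnm0E.
case: i subUU => [[|[|[|//]]] lti] subUU /=.
- rewrite (_ : Ordinal lti = 0) ?subUU in subUU *; last exact: val_inj.
  by rewrite subUU mpolyX0 !rmorph1 rmorph0 mul0r mulr0 addr0 !mulr1.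
- rewrite (_ : Ordinal lti = 1) ?subUU in subUU *; last exact: val_inj.
  by rewrite subUU mpolyX0 !rmorph1 rmorph0 mul0r mulr0 add0r !mulr1.
- by rewrite rmorph0 !mul0r !mulr0 addr0.
Qed.

#[local] Opaque polar.

Lemma polar_drinfeld : polar drinfeld_poly = 0.
Proof.
rewrite /drinfeld_poly !polarB !polarM exprSr polarM !polarXq !polarX /=.
by rewrite !rmorphXn /= !eval_atX; ring.
Qed.

(** The cross difference of two equal fractions is a multiple of the equation. Both [ev] and [polar]
    kill the equation, so by the Leibniz rule [polar] kills the multiple as well. *)
Lemma polar_frac_unique n n' A B A' B' :
    A \is n.-homog -> B \is n.-homog -> A' \is n'.-homog -> B' \is n'.-homog ->
    ev B != 0 -> ev B' != 0 -> ev A / ev B = ev A' / ev B' ->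
  quotient_rule (ev A) (polar A) (ev B) (polar B)
    = quotient_rule (ev A') (polar A') (ev B') (polar B').
Proof.
move=> hA hB hA' hB' B0 B'0 /eqP; rewrite (eqr_div _ _ B0 B'0) => /eqP evE.
have hQ : A * B' - A' * B \is (n + n').-homog.
  by apply: rpredB; [exact: dhomogM|rewrite addnC; exact: dhomogM].
have /(ev_homog_eq0 hQ) [Q QE] : ev (A * B' - A' * B) = 0.
  by rewrite (raddfB (eval_at emb xi)) /= !(rmorphM (eval_at emb xi)) evE subrr.
apply: (quotient_rule_unique B0 B'0 evE); apply/eqP.
rewrite -subr_eq0 -(polarM A) -(polarM A') -polarB QE (polarM Q).
by rewrite ev_drinfeld polar_drinfeld; apply/eqP; move: (polar Q) (ev Q) => a b; ring.
Qed.

Lemma curve_derivation : exists D : L -> L^o,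
  [/\ derivation emb D, D (z 0) = z 0 ^+ q & D (z 1) = z 1 ^+ q].
Proof.
pose frac n A B f := [/\ A \is n.-homog, B \is n.-homog, ev B != 0
  & f = ev A / ev B].
(* Since [polar] raises degrees by q-1, dividing by Z^(q-1) brings the value back to degree 0; this
   normalisation makes D x = x^q and D y = y^q. *)
pose val A B : L :=
  quotient_rule (ev A) (polar A) (ev B) (polar B) / xi 2%R 0 ^+ q.-1.
have [D DE] : {D : L -> L^o & forall f n A B, frac n A B f -> D f = val A B}.
  apply: (@boolp.choice L L^o (fun f y => forall n A B, frac n A B f -> y = val A B)) => f.
  have [n [A [B [hA hB B0 ->]]]] := generic_fractions L_function_field f.
  exists (val A B) => n' A' B' [hA' hB' B'0 eqf]; rewrite /val.
  by rewrite (polar_frac_unique hA hB hA' hB' B0 B'0 eqf).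
have homX i : 'X_i \is [in k[3], 1.-homog] by rewrite dhomogX /= mdeg1.
have Dz i : i != 2%R -> D (z i) = z i ^+ q.
  move=> i2; rewrite (DE _ 1 'X_i 'X_2%R); last by split; rewrite ?eval_atX.
  rewrite /val !polarX (negPf i2) eqxx !eval_atX /quotient_rule mulr0 subr0 expr_div_n.
  have -> : xi 2%R 0 ^+ q = xi 2%R 0 * xi 2%R 0 ^+ q.-1.
    by rewrite -exprS prednK // ltnW.
  by field; rewrite Z_neq0 expf_neq0.
exists D; split; rewrite ?Dz //; split=> [f g|f g|c].
- have [n [A [B [hA hB B0 fE]]]] := generic_fractions L_function_field f.
  have [n' [A' [B' [hA' hB' B'0 gE]]]] := generic_fractions L_function_field g.
  rewrite (DE f n A B) // (DE g n' A' B') //.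
  rewrite (DE _ (n + n')%N (A * B' + A' * B) (B * B')).
    rewrite /val polarD (polarM A) (polarM A') (polarM B).
    rewrite (raddfD (eval_at emb xi)) /= !(rmorphM (eval_at emb xi)).
    by rewrite quotient_ruleD // mulrDl.
  split.
  - by apply: rpredD; [exact: dhomogM|rewrite addnC; exact: dhomogM].
  - exact: dhomogM.
  - by rewrite rmorphM mulf_neq0.
  - rewrite (raddfD (eval_at emb xi)) /= !(rmorphM (eval_at emb xi)).
    by rewrite fE gE addf_div.
- have [n [A [B [hA hB B0 fE]]]] := generic_fractions L_function_field f.
  have [n' [A' [B' [hA' hB' B'0 gE]]]] := generic_fractions L_function_field g.
  rewrite (DE f n A B) // (DE g n' A' B') //.
  rewrite (DE _ (n + n')%N (A * A') (B * B')).
    rewrite /GRing.scale /= /val (polarM A) (polarM B) !(rmorphM (eval_at emb xi)).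
    by rewrite quotient_ruleM // -fE -gE mulrDl !mulrA.
  split.
  - exact: dhomogM.
  - exact: dhomogM.
  - by rewrite rmorphM mulf_neq0.
  - by rewrite !(rmorphM (eval_at emb xi)) fE gE mulf_div.
- rewrite (DE _ 0 c%:MP 1).
    by rewrite /val -mpolyC1 /quotient_rule !polarC mul0r mulr0 subrr !mul0r.
  split; rewrite ?rmorph1 ?oner_eq0 ?eval_atC ?divr1 ?dhomog1 //.
  by rewrite -[c%:MP]mulr1 mul_mpolyC rpredZ ?dhomog1.
Qed.

(** * Differentials of the function field and regularity on the charts *)

Section Forms.

Variables (Omega : lmodType L) (d : L -> Omega).
Hypothesis Omega_kahler : is_kahler emb d.

Let d_der : derivation emb d := kahler_derivation Omega_kahler.

Definition omega : Omega := z 0 *: d (z 1) - z 1 *: d (z 0).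

(** In characteristic p the differential of a q-th power is 0, so the affine equation gives y^q dx =
    x^q dy; multiplying omega by x^q or y^q and using the equation once more isolates dx or dy. *)
Lemma d_affine :
  d (z 0) = z 0 ^+ q *: omega /\ d (z 1) = z 1 ^+ q *: omega.
Proof.
have [dD dM dC] := d_der.
have dXq f : d (f ^+ q) = 0.
  rewrite -[in LHS](prednK (ltnW q_gt1)) (derivationXn d_der).
  by rewrite (prednK (ltnW q_gt1)) q_charL mul0r scale0r.
rewrite /omega; move: affine_eq; move: (z 0) (z 1) => x y xy1.
have := congr1 d xy1.
rewrite dD (derivationN d_der) !dM !dXq (derivation1 d_der) !scaler0 add0r addr0.
move/eqP; rewrite subr_eq0 => /eqP dE; rewrite !scalerBr !scalerA.
split.
  rewrite [x ^+ q * x]mulrC -[(x * _) *: _]scalerA -dE scalerA -scalerBl.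
  by rewrite xy1 scale1r.
rewrite [y ^+ q * y]mulrC -[(y * _) *: _]scalerA dE scalerA -scalerBl.
by rewrite mulrC [y * _]mulrC xy1 scale1r.
Qed.

Lemma d_omega f : exists c, d f = c *: omega.
Proof.
have [dD dM dC] := d_der.
have [dz0 dz1] := d_affine.
(* A quotient of forms of equal degree does not change when both are evaluated at (x, y, 1), so
   polynomials in x and y suffice. *)
have aff P : exists c, d (eval_at emb ((xi 2%R 0)^-1 *: xi) P) = c *: omega.
  pattern (eval_at emb ((xi 2%R 0)^-1 *: xi) P); apply: eval_at_ind => [c|i|a b|a b].
  - by exists 0; rewrite dC scale0r.
  - rewrite mxE mulrC; have [->|/ord3_neq2 [] ->] := eqVneq i 2%R.
    + by exists 0; rewrite divff // (derivation1 d_der) scale0r.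
    + by exists (z 0 ^+ q).
    + by exists (z 1 ^+ q).
  - by move=> [u ua] [v vb]; exists (u + v); rewrite dD ua vb scalerDl.
  - move=> [u ua] [v vb]; exists (a * v + b * u).
    by rewrite dM ua vb !scalerA scalerDl.
have [n [A [B [hA hB B0 ->]]]] := generic_fractions L_function_field f.
have [[u uA] [v vB]] := (aff A, aff B).
move: uA vB; rewrite !(eval_at_scale emb _ xi hA, eval_at_scale emb _ xi hB).
set a := _ * ev A; set b := _ * ev B => uA vB.
have t0 : (xi 2%R 0)^-1 ^+ n != 0 by rewrite expf_neq0 ?invr_eq0.
have b0 : b != 0 by rewrite mulf_neq0.
have -> : ev A / ev B = a / b by rewrite /a /b -mulf_div divff // mul1r.
rewrite dM (derivationV d_der) // uA vB !scalerA -scalerDl.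
by eexists.
Qed.

(** The derivation of the curve factors through [d] by a linear functional, whose value at omega is
    x y^q - y x^q = 1. Hence omega is nonzero, and the functional reads off the coefficient of any
    multiple of omega. *)
Lemma kahler_coordinate : omega != 0 /\ exists D : L -> L^o,
  [/\ derivation emb D, D (z 0) = z 0 ^+ q, D (z 1) = z 1 ^+ q
    & forall f, d f = D f *: omega].
Proof.
have [D [D_der D0 D1]] := curve_derivation.
have [u ud _] := kahler_universal Omega_kahler D_der.
have u1 : u omega = 1.
  by rewrite /omega raddfB /= !linearZ /= !ud D0 D1 /GRing.scale /= [z 1 * _]mulrC
    ?mulNr affine_eq.
split; first by apply/eqP => om0; have /eqP := u1; rewrite om0 linear0 eq_sym oner_eq0.
exists D; split=> // f; have [c dc] := d_omega f.
by have -> : D f = c by rewrite -ud dc linearZ /= u1; exact: mulr1.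
Qed.

Section ChartRing.

Variable i : 'I_3.

Lemma chart_ringC c : chart_ring emb xi i (emb c).
Proof.
exists 0%N, c%:MP; split; last by rewrite eval_atC divr1.
by rewrite -[c%:MP]mulr1 mul_mpolyC rpredZ ?dhomog1.
Qed.

Lemma chart_ring_coord j : chart_ring emb xi i (xi j 0 / xi i 0).
Proof. by exists 1%N, 'X_j; rewrite eval_atX dhomogX /= mdeg1. Qed.

Lemma chart_ringM f g : chart_ring emb xi i f -> chart_ring emb xi i g ->
  chart_ring emb xi i (f * g).
Proof.
move=> [n [A [hA ->]]] [m [B [hB ->]]]; exists (n + m)%N, (A * B).
by rewrite dhomogM // (rmorphM (eval_at emb xi)) exprD mulf_div.
Qed.

Lemma chart_ringD f g : chart_ring emb xi i f -> chart_ring emb xi i g ->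
  chart_ring emb xi i (f + g).
Proof.
have homXn m : 'X_i ^+ m \is [in k[3], m.-homog].
  by rewrite -[X in X.-homog]mul1n dhomogMn // dhomogX /= mdeg1.
move=> [n [A [hA ->]]] [m [B [hB ->]]].
exists (n + m)%N, (A * 'X_i ^+ m + B * 'X_i ^+ n); split.
  by apply: rpredD; [exact: dhomogM|rewrite addnC; exact: dhomogM].
rewrite (raddfD (eval_at emb xi)) /= !(rmorphM (eval_at emb xi)).
rewrite !(rmorphXn (eval_at emb xi)) /= !eval_atX exprD.
by rewrite addf_div ?expf_neq0 ?xi_neq0.
Qed.

Lemma chart_ringXn f n : chart_ring emb xi i f -> chart_ring emb xi i (f ^+ n).
Proof.
move=> hf; elim: n => [|n IHn]; last by rewrite exprS; apply: chart_ringM.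
by rewrite expr0 -(rmorph1 emb); apply: chart_ringC.
Qed.

Lemma chart_ring_ind (S : L -> Prop) :
    (forall c, S (emb c)) -> (forall j, S (xi j 0 / xi i 0)) ->
    (forall a b, S a -> S b -> S (a + b)) ->
    (forall a b, S a -> S b -> S (a * b)) ->
  forall f, chart_ring emb xi i f -> S f.
Proof.
move=> SC Sx SD SM f [n [A [hA ->]]].
rewrite mulrC -exprVn -(eval_at_scale emb _ xi hA).
by apply: eval_at_ind => // j; rewrite mxE mulrC.
Qed.

End ChartRing.

(** This is the numerator of D(z_j / z_i); up to sign it is 0 or the left side of the affine
    equation. *)
Lemma affine_wronskian (i j : 'I_3) : i != 2%R -> j != 2%R ->
  exists c : k, z j ^+ q * z i - z j * z i ^+ q = emb c.
Proof.
have w : z 1 ^+ q * z 0 - z 1 * z 0 ^+ q = 1.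
  by rewrite mulrC [z 1 * _]mulrC affine_eq.
move=> /ord3_neq2 [] -> /ord3_neq2 [] ->.
- by exists 0; rewrite rmorph0 mulrC subrr.
- by exists 1; rewrite rmorph1.
- exists (-1); rewrite rmorphN1 -w opprB; congr (_ - _); exact: mulrC.
- by exists 0; rewrite rmorph0 mulrC subrr.
Qed.

(** It suffices to treat the generators of the chart ring: D(1/z_i) = - z_i^(q-2), and D(z_j / z_i)
    = c / z_i^2 with c constant, which after division by z_i^(q-2) becomes c (Z/X_i)^q. The
    predicate [S] also records membership in the chart ring, which the product rule requires. *)
Lemma chart_derivation (D : L -> L^o) i f :
    derivation emb D -> D (z 0) = z 0 ^+ q -> D (z 1) = z 1 ^+ q ->
    i != 2%R -> chart_ring emb xi i f ->
  chart_ring emb xi i (D f / z i ^+ q.-2).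
Proof.
move=> D_der D0 D1 i2.
have Dz j : j != 2%R -> D (z j) = z j ^+ q.
  by move=> /ord3_neq2 [] ->.
have [DD DM DC] := D_der.
pose S f := chart_ring emb xi i f /\ chart_ring emb xi i (D f / z i ^+ q.-2).
have zq : z i ^+ q = z i ^+ 2 * z i ^+ q.-2.
  by rewrite -exprD add2n; case: (q) q_gt1 => [|[]].
suff Sf g : chart_ring emb xi i g -> S g by move=> /Sf [].
move: g; apply: chart_ring_ind => [c|j|a b [ha Da] [hb Db]|a b [ha Da] [hb Db]].
- split; first exact: chart_ringC.
  by rewrite DC mul0r -(rmorph0 emb); apply: chart_ringC.
- split; first exact: chart_ring_coord.
  have -> : xi j 0 / xi i 0 = z j / z i by rewrite invf_div mulrA divfK.
  have [->|j2] := eqVneq j 2%R.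
    rewrite divff // mul1r (derivationV D_der) // Dz // /GRing.scale /= zq.
    have -> : - (z i ^+ 2)^-1 * (z i ^+ 2 * z i ^+ q.-2) / z i ^+ q.-2 = emb (-1).
      by rewrite rmorphN1 mulNr mulNr mulKf ?expf_neq0 // divff ?expf_neq0.
    exact: chart_ringC.
  have [c cE] := affine_wronskian i2 j2.
  have -> : D (z j / z i) / z i ^+ q.-2 = emb c * (xi 2%R 0 / xi i 0) ^+ q.
    rewrite DM (derivationV D_der) // !Dz // /GRing.scale /= -cE -(invf_div (xi i 0)) exprVn.
    suff fieldE (a b A B e : L) : a != 0 -> e != 0 -> A = a ^+ 2 * e ->
        (b * (- (a ^+ 2)^-1 * A) + a^-1 * B) / e = (B * a - b * A) * A^-1.
      by apply: fieldE => //; rewrite expf_neq0.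
    by move=> a0 e0 ->; field; rewrite a0 e0.
  apply: chart_ringM; first exact: chart_ringC.
  by apply: chart_ringXn; apply: chart_ring_coord.
- split; first exact: chart_ringD.
  by rewrite DD mulrDl; apply: chart_ringD.
- split; first exact: chart_ringM.
  by rewrite DM mulrDl /GRing.scale /= -!mulrA; apply: chart_ringD; apply: chart_ringM.
Qed.

(* The coordinate functions transform by the dual of the natural
   representation; since the determinant is 1, (y, -x) transforms as the
   standard basis. *)
Definition twisted_eval (P : {mpoly k[2]}) : L :=
  mmap emb (fun j : 'I_2 => if j == 0 then z 1 else - z 0) P.

Lemma twisted_evalZ c P : twisted_eval (c *: P) = emb c * twisted_eval P.
Proof. exact: mmapZ. Qed.

Lemma twisted_eval_linear c P Q :
  twisted_eval (c *: P + Q) = emb c * twisted_eval P + twisted_eval Q.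
Proof. by rewrite /twisted_eval mmapD mmapZ. Qed.

Lemma twisted_eval_sum I (s : seq I) (F : I -> {mpoly k[2]}) :
  twisted_eval (\sum_(x <- s) F x) = \sum_(x <- s) twisted_eval (F x).
Proof. exact: raddf_sum. Qed.

Lemma twisted_evalX j : twisted_eval 'X_j = if j == 0 then z 1 else - z 0.
Proof. by rewrite /twisted_eval mmapX mmap1U. Qed.

Lemma twisted_evalXm m : twisted_eval 'X_[m] = \prod_j twisted_eval 'X_j ^+ m j.
Proof.
by rewrite {1}/twisted_eval mmapX; apply: eq_bigr => j _; rewrite twisted_evalX.
Qed.

Lemma twisted_evalXm2 m :
  twisted_eval 'X_[m] = emb ((-1) ^+ m 1) * (z 0 ^+ m 1 * z 1 ^+ m 0).
Proof.
rewrite twisted_evalXm big_ord_recl big_ord1 !twisted_evalX /=.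
rewrite (_ : fintype.lift ord0 ord0 = 1); last exact: val_inj.
by rewrite (exprNn (z 0)) rmorphXn rmorphN1 mulrC -mulrA.
Qed.

Lemma ev_monomial (m : 'X_{1..3}) :
  ev 'X_[m] = xi 2%R 0 ^+ mdeg m * (z 0 ^+ m 0 * z 1 ^+ m 1).
Proof.
have /(eval_at_scale emb (xi 2%R 0) ((xi 2%R 0)^-1 *: xi)) :
  'X_[m] \is [in k[3], (mdeg m).-homog] by rewrite dhomogX.
rewrite scalerA divff // scale1r => ->; congr (_ * _).
rewrite eval_atXm !big_ord_recl big_ord0 mulr1 !mxE.
rewrite (_ : fintype.lift ord0 (fintype.lift ord0 ord0) = 2%R); last exact: val_inj.
rewrite mulVf // expr1n mulr1 (_ : fintype.lift ord0 ord0 = 1); last exact: val_inj.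
by rewrite ![_^-1 * _]mulrC.
Qed.

(** Homogenised to degree q-2, such a polynomial has Z-exponents below q and is already a normal
    form. *)
Lemma twisted_eval_eq0 P : (msize P <= q.-1)%N -> twisted_eval P = 0 -> P = 0.
Proof.
move=> sP P0.
(* The first two exponents are exchanged because [twisted_eval] sends the variables to y and -x; the
   third one pads the degree to q-2. *)
pose h (m : 'X_{1..2}) : 'X_{1..3} := [multinom [tuple m 1; m 0; (q.-2 - mdeg m)%N]].
have hE m : [/\ h m 0 = m 1, h m 1 = m 0 & h m 2%R = (q.-2 - mdeg m)%N].
  by split; rewrite multinomE (tnth_nth 0%N).
have h_inj : injective h.
  move=> m m' hm; have [h0 h1 _] := hE m; have [h'0 h'1 _] := hE m'.
  apply/mnmP => j; have [->|->] : j = 0 \/ j = 1.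
  - by case: j => [[|[|//]] ltj]; [left|right]; apply: val_inj.
  - by rewrite -h1 -h'1 hm.
  - by rewrite -h0 -h'0 hm.
have dm m : m \in msupp P -> mdeg (h m) = q.-2.
  move=> /msize_mdeg_lt /leq_trans /(_ sP) mq.
  have mq2 : (mdeg m <= q.-2)%N by rewrite -ltnS prednK // -subn1 subn_gt0.
  have [h0 h1 h2] := hE m.
  rewrite mdegE !big_ord_recl big_ord0 addn0.
  rewrite (_ : fintype.lift ord0 (fintype.lift ord0 ord0) = 2%R); last exact: val_inj.
  rewrite (_ : fintype.lift ord0 ord0 = 1) ?h0 ?h1 ?h2; last exact: val_inj.
  rewrite addnA -[RHS](subnKC mq2); congr (_ + _)%N.
  rewrite mdegE big_ord_recl big_ord1 addnC.
  by rewrite (_ : fintype.lift ord0 ord0 = 1) //; exact: val_inj.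
pose Q : {mpoly k[3]} := \sum_(m <- msupp P) (P@_m * (-1) ^+ m 1) *: 'X_[h m].
have Qred : reduced q.-2 Q.
  rewrite /Q big_seq; apply: big_ind => [|A B|m /dm hm]; first exact: reduced0.
    exact: reducedD.
  apply: reducedZ; rewrite -hm; apply: reducedX.
  have [_ _ ->] := hE m; apply: leq_trans (leq_subr _ _) _.
  exact: leq_trans (leq_pred _) (leq_pred _).
have Q0 : Q = 0.
  apply: (reduced_ev_eq0 Qred).
  transitivity (xi 2%R 0 ^+ q.-2 * twisted_eval P); last by rewrite P0 mulr0.
  rewrite [P in RHS]mpolyE twisted_eval_sum mulr_sumr /Q raddf_sum.
  apply: eq_big_seq => m /dm hm /=; rewrite eval_atZ twisted_evalZ ev_monomial hm.
  have [-> -> _] := hE m.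
  by rewrite twisted_evalXm2 rmorphM /= mulrCA !mulrA.
apply/mpolyP => m; rewrite mcoeff0.
have [mP|] := boolP (m \in msupp P); last by move/memN_msupp_eq0.
have := congr1 (mcoeff (h m)) Q0; rewrite mcoeff0 /Q raddf_sum /=.
rewrite (bigD1_seq m) ?msupp_uniq //= mcoeffZ mcoeffX eqxx mulr1 big1 ?addr0.
  by move/eqP; rewrite mulf_eq0 signr_eq0 orbF => /eqP.
by move=> w wm; rewrite mcoeffZ mcoeffX (inj_eq h_inj) (negPf wm) mulr0.
Qed.

Lemma ev_twisted n P : P \is n.-homog ->
  exists2 Q, (msize Q <= n.+1)%N & ev P = xi 2%R 0 ^+ n * twisted_eval Q.
Proof.
move=> /dhomogP hP; rewrite [P]mpolyE raddf_sum big_seq.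
apply: (big_ind (fun a => exists2 Q, (msize Q <= n.+1)%N
    & a = xi 2%R 0 ^+ n * twisted_eval Q)).
- by exists 0; rewrite ?msize0 // /twisted_eval mmap0 mulr0.
- move=> _ _ [A sA ->] [B sB ->]; exists (A + B).
    by apply: leq_trans (msizeD_le _ _) _; rewrite geq_max sA.
  by rewrite -mulrDr /twisted_eval mmapD.
- move=> m /hP dm /=.
  (* The sign cancels the one produced by the powers of -x. *)
  exists ((P@_m * (-1) ^+ m 0) *: 'X_[[multinom [tuple m 1; m 0]]]).
    apply: leq_trans (msizeZ_le _ _) _; rewrite msizeX ltnS -dm mdegE.
    rewrite !big_ord_recl !big_ord0 !multinomE !(tnth_nth 0%N) /= addn0.
    rewrite mdegE !big_ord_recl big_ord0 addn0.
    rewrite (_ : fintype.lift ord0 ord0 = 1 :> 'I_3); last exact: val_inj.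
    by rewrite [(m 1%R + _)%N]addnC addnA leq_addr.
  rewrite eval_atZ ev_monomial dm twisted_evalZ twisted_evalXm2.
  rewrite !multinomE !(tnth_nth 0%N) /= mulrCA rmorphM /= -mulrA.
  congr (_ * (_ * _)); rewrite mulrA -[LHS]mul1r; congr (_ * _).
  by rewrite -(rmorphM emb) -expr2 sqrr_sign rmorph1.
Qed.

Section RegularForms.

Variable A : L -> Prop.

Lemma regular_overD w w' : regular_over d A w -> regular_over d A w' ->
  regular_over d A (w + w').
Proof.
move=> [s [sA ->]] [s' [s'A ->]]; exists (s ++ s'); rewrite big_cat; split=> // fg.
by rewrite mem_cat => /orP [/sA|/s'A].
Qed.

Lemma regular_over0 : regular_over d A 0.
Proof. by exists [::]; rewrite big_nil. Qed.

Lemma regular_over1 f g : A f -> A g -> regular_over d A (f *: d g).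
Proof.
move=> Af Ag; exists [:: (f, g)]; rewrite big_seq1; split=> // fg.
by rewrite inE => /eqP ->.
Qed.

End RegularForms.

Ltac in_chart_ring := repeat first
  [ exact: chart_ring_coord | exact: chart_ringC
  | apply: chart_ringXn | apply: chart_ringM ].

Lemma twisted_monomial_holomorphic m c : (mdeg m <= q.-2)%N ->
  holomorphic_form emb d xi (twisted_eval (c *: 'X_[m]) *: omega).
Proof.
move=> mq i.
have [D [D_der D0 D1 dD]] := kahler_coordinate.2.
rewrite twisted_evalZ twisted_evalXm2 mulrA -rmorphM /=.
move: (c * _) => {}c; set f := emb c * _.
have z_chart j : chart_ring emb xi 2%R (z j) := chart_ring_coord 2%R j.
have [->|i2] := eqVneq i 2%R.
  have f_chart : chart_ring emb xi 2%R f.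
    by rewrite /f; in_chart_ring.
  have -> : f *: omega = (f * z 0) *: d (z 1) + (- (f * z 1)) *: d (z 0).
    by rewrite /omega scalerBr !scalerA scaleNr.
  apply: regular_overD; apply: regular_over1 => //; first exact: chart_ringM.
  by rewrite -mulN1r -(rmorphN1 emb); apply: chart_ringM; [apply: chart_ringC|apply: chart_ringM].
have Dz : D (z i) = z i ^+ q by case: (ord3_neq2 i2) => ->.
have zq : z i ^+ q = z i ^+ 2 * z i ^+ q.-2.
  by rewrite -exprD add2n; case: (q) q_gt1 => [|[]].
have -> : f *: omega = (- (f / z i ^+ q.-2)) *: d (xi 2%R 0 / xi i 0).
  have Dt : D (xi 2%R 0 / xi i 0) = - z i ^+ q.-2.
    rewrite -(invf_div (xi i 0)) (derivationV D_der) // Dz zq /GRing.scale /=.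
    by rewrite mulNr mulKf ?expf_neq0.
  by rewrite dD Dt scalerA mulrNN divfK ?expf_neq0.
apply: regular_over1; last exact: chart_ring_coord.
(* The degree bound enters here: the exponents of x and y use up at most q-2 of the factors 1/z_i,
   and the [b] remaining ones become powers of Z/X_i. *)
have [b qE] : exists b, q.-2 = (m 1%R + m 0%R + b)%N.
  exists (q.-2 - mdeg m)%N; rewrite -[LHS](subnKC mq); congr (_ + _)%N.
  rewrite mdegE big_ord_recl big_ord1 addnC.
  by rewrite (_ : fintype.lift ord0 ord0 = 1) //; exact: val_inj.
have -> : - (f / z i ^+ q.-2) = emb (- c) * ((xi 0 0 / xi i 0) ^+ m 1
    * (xi 1 0 / xi i 0) ^+ m 0 * (xi 2%R 0 / xi i 0) ^+ b).
  have xiE j : xi j 0 / xi i 0 = z j / z i by rewrite invf_div mulrA divfK.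
  rewrite (xiE 0) (xiE 1) -(invf_div (xi i 0)) rmorphN mulNr qE /f.
  congr (- _); move: (z_neq0 i); move: (z i) (z 0) (z 1) => t x y t0.
  by rewrite !exprD !expr_div_n exprVn; field; rewrite !expf_neq0.
by in_chart_ring.
Qed.

Lemma regular_on_chart i w : i != 2%R ->
    regular_over d (chart_ring emb xi i) w ->
  exists2 a, w = a *: omega & chart_ring emb xi i (a / z i ^+ q.-2).
Proof.
move=> i2 [s [sA ->]]; have [D [D_der D0 D1 dD]] := kahler_coordinate.2.
rewrite big_seq.
apply: (big_ind (fun w => exists2 a, w = a *: omega
    & chart_ring emb xi i (a / z i ^+ q.-2))).
- exists 0; rewrite ?scale0r // mul0r -(rmorph0 emb); exact: chart_ringC.
- move=> _ _ [a -> ha] [b -> hb]; exists (a + b); rewrite ?scalerDl //.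
  by rewrite mulrDl; apply: chart_ringD.
- move=> fg /sA [hf hg]; exists (fg.1 * D fg.2); first by rewrite dD scalerA.
  rewrite -mulrA; apply: chart_ringM => //; exact: chart_derivation.
Qed.

(** If w = a omega is regular on the charts X and Y, then a Z^(q-2) is, on each of them, a form
    divided by a power of the chart coordinate. Gluing makes it a form of degree q-2, and dividing
    by Z^(q-2) turns that into a polynomial in x, y. *)
Lemma holomorphic_formP w : holomorphic_form emb d xi w <->
  exists2 P, (msize P <= q.-1)%N & w = twisted_eval P *: omega.
Proof.
have q2 : q.-1 = q.-2.+1 by case: (q) q_gt1 => [|[]].
split=> [hol|[P sP ->]].
  have [a wa] := regular_on_chart (isT : 0 != 2%R :> 'I_3) (hol 0).
  have [a' wa'] := regular_on_chart (isT : 1 != 2%R :> 'I_3) (hol 1).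
  have -> : a' = a.
    apply/eqP; rewrite -subr_eq0; move/eqP: wa; rewrite wa' -subr_eq0 -scalerBl.
    by rewrite scaler_eq0 (negPf kahler_coordinate.1) orbF.
  move=> [m [C [hC aC]]] [n [B [hB aB]]]; rewrite wa; clear a' wa' hol.
  have Xn i r : 'X_i ^+ r \is [in k[3], r.-homog].
    by rewrite -[X in X.-homog]mul1n dhomogMn // dhomogX /= mdeg1.
  pose b := a * xi 2%R 0 ^+ q.-2.
  (* The extra exponent [r] brings the denominators X^n and Y^m to the common exponent n+m. *)
  have bE j l E r : a / z j ^+ q.-2 = ev E / xi j 0 ^+ l ->
      xi j 0 ^+ (l + r) * b = ev ('X_j ^+ (q.-2 + r) * E).
    move=> aE; rewrite (rmorphM (eval_at emb xi)) (rmorphXn (eval_at emb xi)) /=.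
    rewrite eval_atX; have -> : ev E = a / z j ^+ q.-2 * xi j 0 ^+ l.
      by rewrite aE divfK // expf_neq0 ?xi_neq0.
    rewrite /b; move: (xi_neq0 j); move: Z_neq0.
    move: (xi j 0) (xi 2%R 0) => x t t0 x0.
    by rewrite expr_div_n !exprD; field; rewrite !expf_neq0.
  have hB' : 'X_0 ^+ (q.-2 + m) * B \is (n + m + q.-2).-homog.
    by rewrite (_ : n + m + q.-2 = q.-2 + m + n)%N; [exact: dhomogM|ring].
  have hC' : 'X_1 ^+ (q.-2 + n) * C \is (n + m + q.-2).-homog.
    by rewrite (_ : n + m + q.-2 = q.-2 + n + m)%N; [exact: dhomogM|ring].
  have bB := bE _ _ _ m aB; have bC := bE _ _ _ n aC.
  rewrite (addnC m) in bC.
  have eqBC : xi 0 0 ^+ (n + m) * ev ('X_1 ^+ (q.-2 + n) * C)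
      = xi 1 0 ^+ (n + m) * ev ('X_0 ^+ (q.-2 + m) * B).
    by rewrite -bB -bC mulrCA.
  have [P rP] := ev_glue hB' hC' eqBC.
  rewrite -bC => /(mulfI (expf_neq0 _ (xi_neq0 1))).
  have [Q sQ ->] := ev_twisted (reduced_homog rP).
  rewrite /b [a * _]mulrC.
  have Zq : xi 2%R 0 ^+ q.-2 != 0 by rewrite expf_neq0.
  move=> /(mulfI Zq) aQ.
  exists Q; first by rewrite q2.
  by rewrite aQ.
rewrite [P]mpolyE twisted_eval_sum scaler_suml => i; rewrite big_seq.
apply: big_ind => [|w1 w2|m mP]; [exact: regular_over0|exact: regular_overD|].
apply: twisted_monomial_holomorphic; rewrite -ltnS -q2.
exact: leq_trans (msize_mdeg_lt mP) sP.
Qed.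

End Forms.

Lemma twisted_eval_sym_act (s : {rmorphism L -> L}) (A : 'M[k]_2) P :
    (forall c, s (emb c) = emb c) ->
    (forall j, s (twisted_eval 'X_j)
      = \sum_l emb (A l j) * twisted_eval 'X_l) ->
  s (twisted_eval P) = twisted_eval (sym_act A P).
Proof.
move=> sC sX; rewrite [P]mpolyE sym_act_sum !twisted_eval_sum rmorph_sum.
apply: eq_bigr => m _ /=; rewrite !twisted_evalZ rmorphM /= sC; congr (_ * _).
rewrite twisted_evalXm sym_actXm rmorph_prod /twisted_eval rmorph_prod.
apply: eq_bigr => j _ /=; rewrite !rmorphXn /= -!/(twisted_eval _) sX sym_actX.
rewrite twisted_eval_sum; congr (_ ^+ _); apply: eq_bigr => l _.
by rewrite twisted_evalZ.
Qed.

End DrinfeldCurve.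

(** * The action of SL_2 on functions and forms *)

Section SL2Action.

Lemma det_mx2 (R : comNzRingType) (A : 'M[R]_2) :
  \det A = A 0 0 * A 1 1 - A 0 1 * A 1 0.
Proof.
have l1 : fintype.lift ord0 ord0 = 1 :> 'I_2 by exact: val_inj.
have l0 : fintype.lift 1 ord0 = 0 :> 'I_2 by exact: val_inj.
rewrite (expand_det_row _ ord0) big_ord_recl big_ord1 /cofactor !det_mx11 !mxE.
by rewrite !l1 l0 expr0 mul1r expr1 mulN1r mulrN.
Qed.

Lemma mul_mx2E (R : nzRingType) (A B : 'M[R]_2) i j :
  (A *m B) i j = A i 0 * B 0 j + A i 1 * B 1 j.
Proof.
rewrite mxE big_ord_recl big_ord1.
by rewrite (_ : fintype.lift _ _ = 1) //; exact: val_inj.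
Qed.

(** Cramer's rule: for determinant 1 the inverse is the adjugate, and each entry comes from one row
    of the equation [B *m A = 1]. *)
Lemma inv_SL2E (R : comNzRingType) (A B : 'M[R]_2) : B *m A = 1 -> \det A = 1 ->
  [/\ B 0 0 = A 1 1, B 0 1 = - A 0 1, B 1 0 = - A 1 0 & B 1 1 = A 0 0].
Proof.
move=> /matrixP BA; rewrite det_mx2 => detA.
have := (BA 0 0, BA 0 1, BA 1 0, BA 1 1); rewrite !mul_mx2E !mxE /=.
move=> [[[e00 e01] e10] e11].
split.
- transitivity (A 1 1 * (B 0 0 * A 0 0 + B 0 1 * A 1 0)
    - A 1 0 * (B 0 0 * A 0 1 + B 0 1 * A 1 1)); last by rewrite e00 e01; ring.
  by rewrite -[LHS]mulr1 -detA; ring.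
- transitivity (A 0 0 * (B 0 0 * A 0 1 + B 0 1 * A 1 1)
    - A 0 1 * (B 0 0 * A 0 0 + B 0 1 * A 1 0)); last by rewrite e00 e01; ring.
  by rewrite -[LHS]mulr1 -detA; ring.
- transitivity (A 1 1 * (B 1 0 * A 0 0 + B 1 1 * A 1 0)
    - A 1 0 * (B 1 0 * A 0 1 + B 1 1 * A 1 1)); last by rewrite e10 e11; ring.
  by rewrite -[LHS]mulr1 -detA; ring.
- transitivity (A 0 0 * (B 1 0 * A 0 1 + B 1 1 * A 1 1)
    - A 0 1 * (B 1 0 * A 0 0 + B 1 1 * A 1 0)); last by rewrite e10 e11; ring.
  by rewrite -[LHS]mulr1 -detA; ring.
Qed.

Variables (Fq : finFieldType) (k L : fieldType).
Variables (iota : {rmorphism Fq -> k}) (emb : {rmorphism k -> L}).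

Lemma det_natural_mx g : g \in SL2 Fq -> \det (natural_mx iota g) = 1.
Proof. by rewrite inE /natural_mx det_map_mx => /eqP ->; rewrite rmorph1. Qed.

Lemma act_pointE g (v : 'cV[L]_3) (B := natural_mx iota g) :
  [/\ act_point iota emb g v 0 0 = emb (B 0 0) * v 0 0 + emb (B 0 1) * v 1 0,
      act_point iota emb g v 1 0 = emb (B 1 0) * v 0 0 + emb (B 1 1) * v 1 0
    & act_point iota emb g v 2%R 0 = v 2%R 0].
Proof.
(* The block matrix is indexed by ['I_(2 + 1)], so the coordinates are matched with left and right
   shifts. *)
have e0 : 0 = lshift 1 0 :> 'I_(2 + 1) by exact: val_inj.
have e1 : 1 = lshift 1 1 :> 'I_(2 + 1) by exact: val_inj.
have e2 : 2%R = rshift 2 0 :> 'I_(2 + 1) by exact: val_inj.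
have sumE (F : 'I_3 -> L) : \sum_j F j = F 0 + F 1 + F 2%R.
  rewrite !big_ord_recl big_ord0 addr0 addrA; congr (_ + F _ + F _); exact: val_inj.
have actE i : act_point iota emb g v i 0 = \sum_j emb (coord_mx iota g i j) * v j 0.
  by rewrite mxE; apply: eq_bigr => j _; rewrite mxE.
rewrite !actE !sumE /coord_mx -/B.
have cE (i j : 'I_2) : block_mx B 0 0 (1%:M : 'M_1) (lshift 1 i) (lshift 1 j) = B i j.
  exact: block_mxEul.
have c2 (i : 'I_2) : block_mx B 0 0 (1%:M : 'M_1) (lshift 1 i) (rshift 2 0) = 0.
  by rewrite block_mxEur mxE.
have c2' (i : 'I_2) : block_mx B 0 0 (1%:M : 'M_1) (rshift 2 0) (lshift 1 i) = 0.
  by rewrite block_mxEdl mxE.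
have c22 : block_mx B 0 0 (1%:M : 'M_1) (rshift 2 0) (rshift 2 0) = 1.
  by rewrite block_mxEdr mxE.
split.
- rewrite -(cE 0 0) -(cE 0 1) -e0 -e1.
  have := c2 0; rewrite -e0 -e2 => ->; by rewrite rmorph0 mul0r addr0.
- rewrite -(cE 1 0) -(cE 1 1) -e0 -e1.
  have := c2 1; rewrite -e1 -e2 => ->; by rewrite rmorph0 mul0r addr0.
- have := (c2' 0, c2' 1, c22); rewrite -e0 -e1 -e2 => -[[-> ->] ->].
  by rewrite rmorph0 rmorph1 !mul0r mul1r !add0r.
Qed.

Variables (xi : 'cV[L]_3) (sigma : {'GL_2[Fq]} -> {rmorphism L -> L}).
Hypothesis sigma_induced : induced_on_functions iota emb xi sigma.

Local Notation z i := (xi i 0 / xi 2%R 0).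

(** Functions are moved through g^-1, whose entries are those of the adjugate; Z is fixed, so ratios
    to Z transform linearly. *)
Lemma sigma_affine g (A := natural_mx iota g) : g \in SL2 Fq ->
  sigma g (z 0) = emb (A 1 1) * z 0 - emb (A 0 1) * z 1
  /\ sigma g (z 1) = - emb (A 1 0) * z 0 + emb (A 0 0) * z 1.
Proof.
move=> Gg; have [_ sE] := sigma_induced Gg.
have BA : natural_mx iota g^-1 *m A = 1.
  by rewrite /A /natural_mx -map_mxM (_ : _ *m _ = GLval (g^-1 * g)%g) // mulVg GL_1E map_mx1.
have [B00 B01 B10 B11] := inv_SL2E BA (det_natural_mx Gg).
rewrite (sE 0 2%R) (sE 1 2%R) /=; have [-> -> ->] := act_pointE g^-1 xi.
by rewrite B00 B01 B10 B11 !rmorphN !mulrDl !mulNr !mulrA.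
Qed.

Lemma sigma_twisted_eval g P : g \in SL2 Fq ->
  sigma g (twisted_eval emb xi P)
    = twisted_eval emb xi (sym_act (natural_mx iota g) P).
Proof.
move=> Gg; have [s0 s1] := sigma_affine Gg.
apply: twisted_eval_sym_act => [c|j]; first exact: (sigma_induced Gg).1.
rewrite big_ord_recl big_ord1 !twisted_evalX /=.
rewrite (_ : fintype.lift ord0 ord0 = 1); last exact: val_inj.
case: j => [[|[|//]] ltj] /=.
  rewrite (_ : Ordinal ltj = 0) ?s1; last exact: val_inj.
  by rewrite mulrN addrC mulNr.
rewrite (_ : Ordinal ltj = 1) ?rmorphN /= ?s0; last exact: val_inj.
by rewrite opprB mulrN.
Qed.

Variables (Omega : lmodType L) (d : L -> Omega).
Variable act : {'GL_2[Fq]} -> Omega -> Omega.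
Hypothesis d_der : derivation emb d.
Hypothesis act_induced : induced_on_forms d sigma act.

(* omega is invariant because the determinant is 1. *)
Lemma act_twisted_form g P : g \in SL2 Fq ->
  act g (twisted_eval emb xi P *: omega xi d)
    = twisted_eval emb xi (sym_act (natural_mx iota g) P) *: omega xi d.
Proof.
move=> Gg; have [actD actM] := act_induced Gg; have [dD dM dC] := d_der.
set f := twisted_eval emb xi P.
have -> : f *: omega xi d = (f * z 0) *: d (z 1) + (- (f * z 1)) *: d (z 0).
  by rewrite /omega scalerBr !scalerA scaleNr.
rewrite actD !actM rmorphN !(rmorphM (sigma g) f) /= -sigma_twisted_eval // -/f scaleNr -!scalerA -scalerBr.
congr (_ *: _); have [-> ->] := sigma_affine Gg; rewrite /omega.
have := congr1 emb (det_natural_mx Gg); rewrite det_mx2 rmorphB /= !(rmorphM emb) rmorph1 /=.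
have dCM c h : d (emb c * h) = emb c *: d h by rewrite dM dC scaler0 addr0.
rewrite dD mulNr (derivationN d_der) dD (derivationN d_der) !dCM.
move: (emb _) (emb _) (emb _) (emb _) (z 0) (z 1) => a b c e x y det1.
move: (d x) (d y) => u v.
(* After collecting the coefficients of dy and dx, each is a coordinate times the determinant. *)
transitivity (((c * x - b * y) * e + (- (a * x) + e * y) * b) *: v
    - ((c * x - b * y) * a + (- (a * x) + e * y) * c) *: u).
  rewrite scalerDr scalerN scalerBr !scalerA [in RHS]scalerDl [in RHS]scalerDl.
  by rewrite opprB [- (_ *: u) + _]addrC -!addrA; congr (_ + _); rewrite addrCA opprD.
congr (_ *: _ - _ *: _).
  by rewrite -[RHS]mul1r -det1; ring.
by rewrite -[RHS]mul1r -det1; ring.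
Qed.

End SL2Action.

(** * The module of holomorphic forms and its class *)

Lemma natr_card_eq0 (p e : nat) (F : finFieldType) : prime p -> (0 < e)%N ->
  #|F| = (p ^ e)%N -> (p ^ e)%:R = 0 :> F.
Proof.
move=> p_prime e_gt0 cF.
have /pcharf0 pF := card_finPcharP cF p_prime.
by rewrite natrX pF expr0n gtn_eqF.
Qed.

Theorem theorem1p1 (p e q : nat) (p_prime : prime p) (e_gt0 : (0 < e)%N)
    (q_def : q = (p ^ e)%N) (Fq : finFieldType) (card_Fq : #|Fq| = q)
    (W : idomainType) (redW : {rmorphism W -> Fq})
    (W_witt : is_witt_ring p redW)
    (K : fieldExtType {fraction W})
    (R : realType) (K_large : complex_irr_realisable R K (SL2_group Fq))
    (k : fieldType) (redK : {rmorphism integers K -> k})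
    (iota : {rmorphism Fq -> k}) (k_residue : is_residue_field redW redK iota)
    (L : fieldType) (emb : {rmorphism k -> L}) (xi : 'cV[L]_3)
    (L_function_field :
       is_function_field emb (map_mpoly iota (drinfeld_form Fq q)) xi)
    (Omega : lmodType L) (d : L -> Omega) (Omega_kahler : is_kahler emb d)
    (sigma : {'GL_2[Fq]} -> {rmorphism L -> L})
    (sigma_induced : induced_on_functions iota emb xi sigma)
    (act : {'GL_2[Fq]} -> Omega -> Omega)
    (act_induced : induced_on_forms d sigma act) :
  exists n (r : mx_representation k (SL2_group Fq) n),
    affords emb act (holomorphic_form emb d xi) r /\
    G0_class r = \sum_(i < q.-1) G0_class (sym_repr iota i).
Proof.
have q_gt1 : (1 < q)%N.
  by rewrite q_def -(expn0 p) ltn_exp2l ?prime_gt1.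
have q_char : q%:R = 0 :> k.
  have := natr_card_eq0 p_prime e_gt0; rewrite -q_def => /(_ _ card_Fq) Fq_char.
  by rewrite -(rmorph_nat iota) Fq_char rmorph0.
have curve : is_function_field emb (drinfeld_poly k q) xi.
  suff <- : map_mpoly iota (drinfeld_form Fq q) = drinfeld_poly k q by [].
  by rewrite /drinfeld_form !rmorphB !rmorphM !rmorphXn /= !map_mpolyX.
have [n [r [phi [phi_lin phi_inj phi_im phi_act r_class]]]] :=
  bounded_degree_repr iota q.-1.
have phi_msize v : (msize (phi v) <= q.-1)%N by apply/phi_im; exists v.
have omega_neq0 := (kahler_coordinate q_gt1 q_char curve Omega_kahler).1.
exists n, r; split=> //.
exists (fun v => twisted_eval emb xi (phi v) *: omega xi d); split.
- by move=> a u v; rewrite phi_lin twisted_eval_linear scalerDl scalerA.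
- move=> u v /eqP; rewrite -subr_eq0 -scalerBl scaler_eq0 (negPf omega_neq0) orbF.
  move=> /eqP uv; apply: phi_inj; apply/eqP; rewrite -subr_eq0; apply/eqP.
  (* Written as a value of [phi], the difference has degree at most q-2, as the injectivity of
     [twisted_eval] on such polynomials demands. *)
  have uvE : phi (-1 *: v + u) = phi u - phi v.
    by rewrite phi_lin scaleN1r addrC.
  apply: (twisted_eval_eq0 q_gt1 curve); rewrite -uvE // phi_lin.
  by rewrite twisted_eval_linear rmorphN1 mulN1r addrC.
- move=> w; rewrite (holomorphic_formP q_gt1 q_char curve Omega_kahler).
  split=> [[P /phi_im [v ->] ->]|[v ->]]; first by exists v.
  by exists (phi v).
- move=> g v Gg; rewrite phi_act //.
  by rewrite (act_twisted_form sigma_induced (kahler_derivation Omega_kahler) act_induced).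
Qed.
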